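(* Let $B \subseteq \omega$ be a set that is not arithmetical. Then for every set $A \subseteq \omega$ there is an infinite set $H$ with $H \subseteq A$ or $H \subseteq \omega \setminus A$ such that $B$ is not arithmetical in $H$ (i.e. $B$ is not $H^{(n)}$-computable for any $n \in \omega$). *)

(* Defs.v *)
From HB Require Import structures.
From mathcomp Require Import all_boot.
From Stdlib Require Import ClassicalEpsilon.
Set Implicit Arguments. Unset Strict Implicit. Unset Printing Implicit Defensive.

Definition natset := nat -> bool.

(* Instructions of an oracle register (Minsky) machine; registers are
   indexed by nat (unboundedly many).
   Inc r     : R r := R r + 1, go to next instruction
   DecJz r j : if R r = 0 then jump to j else R r := R r - 1 and go on
   Ask r     : R r := X (R r)  (oracle query, 1 if in X, 0 otherwise) *)
Inductive instr := Inc of nat | DecJz of nat & nat | Ask of nat.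

Definition instr_code (i : instr) : nat * (nat * nat) :=
  match i with
  | Inc r => (0, (r, 0))
  | DecJz r j => (1, (r, j))
  | Ask r => (2, (r, 0))
  end.
Definition instr_decode (c : nat * (nat * nat)) : option instr :=
  match c with
  | (0, (r, _)) => Some (Inc r)
  | (1, (r, j)) => Some (DecJz r j)
  | (2, (r, _)) => Some (Ask r)
  | _ => None
  end.
Lemma instr_codeK : pcancel instr_code instr_decode.
Proof. by case. Qed.
HB.instance Definition _ := Countable.copy instr (pcan_type instr_codeK).

Definition program := seq instr.

(* configuration: program counter and register contents *)
Definition config := (nat * (nat -> nat))%type.

Definition upd (R : nat -> nat) (r v : nat) : nat -> nat :=
  fun i => if i == r then v else R i.

Definition step (X : natset) (p : program) (c : config) : config :=
  let: (pc, R) := c in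
  match nth None (map Some p) pc with
  | Some (Inc r) => (pc.+1, upd R r (R r).+1)
  | Some (DecJz r j) => if R r == 0 then (j, R) else (pc.+1, upd R r (R r).-1)
  | Some (Ask r) => (pc.+1, upd R r (nat_of_bool (X (R r))))
  | None => c (* halted: pc outside the program *)
  end.

Definition init (x : nat) : config := (0, fun i => if i == 0 then x else 0).

Definition run (X : natset) (p : program) (k x : nat) : config :=
  iter k (step X p) (init x).

Definition halts (X : natset) (p : program) (x : nat) : Prop :=
  exists k, size p <= (run X p k x).1.

Definition computes (X : natset) (p : program) (B : natset) : Prop :=
  forall x, exists k, size p <= (run X p k x).1 /\
                      (run X p k x).2 0 = nat_of_bool (B x).

Definition computable_in (X B : natset) : Prop := exists p, computes X p B.

Definition asbool (P : Prop) : bool :=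
  if excluded_middle_informative P then true else false.

Definition jump (X : natset) : natset :=
  fun n => asbool (exists (p : program) (x : nat),
                      pickle (p, x) = n /\ halts X p x).

Definition njump (n : nat) (X : natset) : natset := iter n jump X.

Definition arithmetical_in (H B : natset) : Prop :=
  exists n, computable_in (njump n H) B.

Definition arithmetical (B : natset) : Prop := arithmetical_in (fun _ => false) B.

Definition infinite_set (H : natset) : Prop := forall m, exists n, m <= n /\ H n.

(* Main.v *)
Require Import Defs.
From mathcomp Require Import all_boot zify.
From Stdlib Require Import Classical ClassicalEpsilon FunctionalExtensionality PropExtensionality.
Set Implicit Arguments. Unset Strict Implicit. Unset Printing Implicit Defensive.

(** A set is arithmetical in [H] iff it is first-order definable with oracle
    [H], so [H] is built by forcing with formulas.  A condition is a finite set
    [s] with an infinite reservoir [X]; the new elements come from [X].  The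
    naive relation "[(s, X)] forces [~ f]" quantifies over reservoirs and is not
    arithmetical.  Instead, consider the open class [cls f (s, E)] of the sets
    [Y] such that [s] can be extended inside [Y] to a finite set forcing [f] in
    the environment [E], fix a maximal collection of such classes that remains
    large (every finite colouring of a final segment of the integers has a
    colour belonging to all the classes of any finite subcollection), and let
    [s] force [~ f] when [cls f (s, E)] is not in the collection.  By
    compactness largeness is an arithmetical property; the collection is chosen
    greedily, one formula after the other, so its trace on each formula is
    arithmetical.

    The sets that are not finite unions of sets missing some chosen class,
    modulo finite sets, are partition regular, and the reservoirs are taken
    among them.  Hence [A] or its complement is a reservoir, every reservoir
    meets each chosen class, and each class that was not chosen is avoided by
    some smaller reservoir.  Given [s] and a formula [f], the set of the [x] such
    that [cls f (s, x)] is chosen is arithmetical, so it differs from [B] at some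
    [x]; extending the condition accordingly makes [f] a wrong definition of [B]
    from [H]. *)

(** * Codes of finite sequences, formulas and definability *)

Lemma asboolP (P : Prop) : reflect P (asbool P).
Proof. by rewrite /asbool; case: excluded_middle_informative => h; constructor. Qed.

(* The [i]-th entry of the sequence coded by [s], and 0 past its end. *)
Definition dec (s i : nat) : nat := nth 0 (CodeSeq.decode s) i.
Definition ccons (a l : nat) : nat := CodeSeq.code (a :: CodeSeq.decode l).
Definition cdrop (i s : nat) : nat := CodeSeq.code (drop i (CodeSeq.decode s)).

Lemma dec_code s i : dec (CodeSeq.code s) i = nth 0 s i.
Proof. by rewrite /dec CodeSeq.codeK. Qed.

Lemma dec_ccons a l i : dec (ccons a l) i = if i is j.+1 then dec l j else a.
Proof. by rewrite dec_code; case: i. Qed.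

Lemma dec_cdrop i s j : dec (cdrop i s) j = dec s (i + j).
Proof. by rewrite dec_code nth_drop. Qed.

Lemma cdrop_ccons a l : cdrop 1 (ccons a l) = l.
Proof. by rewrite /cdrop /ccons CodeSeq.codeK /= drop0 CodeSeq.decodeK. Qed.

Lemma ccons_eta c : c <> 0 -> c = ccons (dec c 0) (cdrop 1 c).
Proof.
rewrite /ccons /cdrop /dec CodeSeq.codeK => h.
move: (CodeSeq.decodeK c) h; case: (CodeSeq.decode c) => [<- //|a l <- _].
by rewrite /= drop0.
Qed.

Lemma ccons_neq0 a l : ccons a l <> 0.
Proof. by move=> h; have := CodeSeq.codeK (a :: CodeSeq.decode l); rewrite -/(ccons a l) h. Qed.

Lemma ccons_eq a l c : c = ccons a l <-> [/\ c <> 0, dec c 0 = a & cdrop 1 c = l].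
Proof.
split=> [->|[h <- <-]]; last exact: ccons_eta.
by split; [apply: ccons_neq0 | rewrite dec_ccons | rewrite cdrop_ccons].
Qed.

Lemma cdrop_eq0 i s : cdrop i s = 0 <-> size (CodeSeq.decode s) <= i.
Proof.
split=> [h|h]; last by rewrite /cdrop drop_oversize.
have := congr1 CodeSeq.decode h; rewrite CodeSeq.codeK => h2.
by have := congr1 size h2; rewrite size_drop => /eqP.
Qed.

Lemma dec_exists (f : nat -> nat) n : exists s, forall i, dec s i = if i < n then f i else 0.
Proof.
exists (CodeSeq.code (mkseq f n)) => i; rewrite dec_code; case: ltnP => h.
  by rewrite nth_mkseq.
by rewrite nth_default // size_mkseq.
Qed.

Definition env := nat -> nat.
Definition scons (v : nat) (e : env) : env := fun i => if i is j.+1 then e j else v.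

(** Head and drop on sequence codes are primitive, which gives access to finite sequences without an
    arithmetical coding. Equality, successor and the constants are derived from [<]. *)
Inductive term := TVar of nat | THd of nat | TDrop of nat & nat.

Inductive form :=
| Lt of term & nat
| Orc of nat
| Not of form
| And of form & form
| Ex of form.

Definition teval (t : term) (e : env) : nat :=
  match t with
  | TVar i => e i
  | THd i => dec (e i) 0
  | TDrop i j => cdrop (e i) (e j)
  end.

Fixpoint sat (H : natset) (f : form) (e : env) : Prop :=
  match f with
  | Lt t j => teval t e < e j
  | Orc i => H (e i)
  | Not f => ~ sat H f e
  | And f g => sat H f e /\ sat H g e
  | Ex f => exists v, sat H f (scons v e)
  end.

Lemma dec_scons a l : dec (ccons a l) = scons a (dec l).
Proof. by apply: functional_extensionality => i; rewrite dec_ccons; case: i. Qed.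

(** * Closure properties of definability *)

Section Definability.
Variable H : natset.

Definition Df (P : env -> Prop) := exists f, forall e, sat H f e <-> P e.
Definition Dfun (f : env -> nat) := Df (fun e => e 0 = f (fun i => e i.+1)).

Lemma Df_ext (P Q : env -> Prop) : (forall e, P e <-> Q e) -> Df P -> Df Q.
Proof. by move=> PQ [f hf]; exists f => e; rewrite hf. Qed.

Lemma Df_not P : Df P -> Df (fun e => ~ P e).
Proof. by case=> f hf; exists (Not f) => e /=; rewrite hf. Qed.

Lemma Df_and P Q : Df P -> Df Q -> Df (fun e => P e /\ Q e).
Proof. by move=> [f hf] [g hg]; exists (And f g) => e /=; rewrite hf hg. Qed.

Lemma Df_or P Q : Df P -> Df Q -> Df (fun e => P e \/ Q e).
Proof.
move=> hP hQ; apply: Df_ext (Df_not (Df_and (Df_not hP) (Df_not hQ))) => e /=.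
by tauto.
Qed.

Lemma Df_imp P Q : Df P -> Df Q -> Df (fun e => P e -> Q e).
Proof.
move=> hP hQ; apply: Df_ext (Df_or (Df_not hP) hQ) => e /=; tauto.
Qed.

Lemma Df_iff P Q : Df P -> Df Q -> Df (fun e => P e <-> Q e).
Proof. by move=> hP hQ; apply: Df_and; apply: Df_imp. Qed.

Lemma Df_ex (P : nat -> env -> Prop) :
  Df (fun e => P (e 0) (fun i => e i.+1)) -> Df (fun e => exists x, P x e).
Proof.
by case=> f hf; exists (Ex f) => e /=; split=> -[x hx]; exists x; move: hx; rewrite hf.
Qed.

Lemma Df_all (P : nat -> env -> Prop) :
  Df (fun e => P (e 0) (fun i => e i.+1)) -> Df (fun e => forall x, P x e).
Proof.
move=> hP; apply: Df_ext (Df_not (Df_ex (P := fun x e => ~ P x e) (Df_not hP))) => e /=.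
by split=> [h x|h [x]]; [apply: NNPP => hx; apply: h; exists x | apply].
Qed.

Lemma Df_ren P (r : nat -> nat) : Df P -> Df (fun e => P (fun i => e (r i))).
Proof.
case=> f hf; apply: (@Df_ext (fun e => sat H f (fun i => e (r i)))).
  by move=> e; rewrite hf.
elim: f r {P hf} => [t j|i|f IH|f IHf g IHg|f IH] r /=.
- exists (Lt (match t with TVar i => TVar (r i) | THd i => THd (r i)
               | TDrop i k => TDrop (r i) (r k) end) (r j)) => e /=.
  by case: t.
- by exists (Orc (r i)).
- exact/Df_not.
- exact: Df_and.
- have [g hg] := IH (fun i => if i is j.+1 then (r j).+1 else 0).
  exists (Ex g) => e /=; split=> -[v hv]; exists v; move: hv; rewrite hg.
    by congr (sat H f _); apply: functional_extensionality => -[].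
  by congr (sat H f _); apply: functional_extensionality => -[].
Qed.

Lemma Dfun_shift (f : env -> nat) : Dfun f -> Dfun (fun e => f (fun i => e i.+1)).
Proof. by apply: (Df_ren (fun i => if i is j.+1 then j.+2 else 0)). Qed.

Lemma Df_lt_var i j : Df (fun e => e i < e j).
Proof. by exists (Lt (TVar i) j). Qed.

Lemma Df_eq_var i j : Df (fun e => e i = e j).
Proof.
apply: Df_ext (Df_and (Df_not (Df_lt_var i j)) (Df_not (Df_lt_var j i))) => e; lia.
Qed.

Lemma Dfun_var i : Dfun (fun e => e i).
Proof. exact: Df_eq_var. Qed.

Lemma Df_let (f : env -> nat) (P : nat -> env -> Prop) :
  Dfun f -> Df (fun e => P (e 0) (fun i => e i.+1)) -> Df (fun e => P (f e) e).
Proof.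
move=> hf hP; apply: Df_ext (@Df_ex (fun x e => x = f e /\ P x e) (Df_and hf hP)) => e.
by split=> [[x [-> //]]|]; exists (f e).
Qed.

(** A definable function need not be a term, so in each atomic formula its value is first bound by a
    quantifier, through [Df_let]. *)
Lemma Df_subst P (t : nat -> env -> nat) :
  Df P -> (forall i, Dfun (t i)) -> Df (fun e => P (fun i => t i e)).
Proof.
case=> f hf ht; apply: (@Df_ext (fun e => sat H f (fun i => t i e))).
  by move=> e; rewrite hf.
elim: f t ht {P hf} => [u j|i|f IH|f IHf g IHg|f IH] t ht /=.
- apply: (@Df_let (t j) (fun x e => teval u (fun i => t i e) < x)) => //.
  case: u => [i|i|i k] /=.
  + apply: (@Df_let (fun e => t i (fun i => e i.+1)) (fun x e => x < e 0)).
      exact: Dfun_shift.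
    exact: Df_lt_var.
  + apply: (@Df_let (fun e => t i (fun i => e i.+1)) (fun x e => dec x 0 < e 0)).
      exact: Dfun_shift.
    by exists (Lt (THd 0) 1).
  + apply: (@Df_let (fun e => t i (fun i => e i.+1))
              (fun x e => cdrop x (t k (fun i => e i.+1)) < e 0)).
      exact: Dfun_shift.
    apply: (@Df_let (fun e => t k (fun i => e i.+2)) (fun x e => cdrop (e 0) x < e 1)).
      exact: (Dfun_shift (Dfun_shift (ht k))).
    by exists (Lt (TDrop 1 0) 2).
- by apply: (@Df_let (t i) (fun x e => H x)) => //; exists (Orc 0).
- exact/Df_not/IH.
- by apply: Df_and; [apply: IHf | apply: IHg].
- apply: (@Df_ex (fun v e => sat H f (scons v (fun i => t i e)))).
  have := IH (fun i => if i is j.+1 then (fun e => t j (fun i => e i.+1)) else (fun e => e 0)).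
  move=> h; apply: Df_ext (h _) => [e|[|i]].
  + by set e1 := (fun i => _); have -> : e1 = scons (e 0) (fun i => t i (fun i0 => e i0.+1));
      [apply: functional_extensionality => -[] | ].
  + exact: Dfun_var.
  + exact: Dfun_shift.
Qed.

Lemma Df_app1 (R : nat -> Prop) f : Df (fun e => R (e 0)) -> Dfun f -> Df (fun e => R (f e)).
Proof. by move=> hR hf; apply: (@Df_let f (fun x e => R x)). Qed.

Lemma Df_app2 (R : nat -> nat -> Prop) f g :
  Df (fun e => R (e 0) (e 1)) -> Dfun f -> Dfun g -> Df (fun e => R (f e) (g e)).
Proof.
move=> hR hf hg; apply: (Df_subst (t := fun i => if i is 0 then f else g) hR).
by case.
Qed.

Lemma Df_app3 (R : nat -> nat -> nat -> Prop) f g h :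
  Df (fun e => R (e 0) (e 1) (e 2)) -> Dfun f -> Dfun g -> Dfun h ->
  Df (fun e => R (f e) (g e) (h e)).
Proof.
move=> hR hf hg hh.
apply: (Df_subst (t := fun i => match i with 0 => f | 1 => g | _ => h end) hR).
by case=> [|[]].
Qed.

Lemma Dfun_app1 (h : nat -> nat) f :
  Df (fun e => e 0 = h (e 1)) -> Dfun f -> Dfun (fun e => h (f e)).
Proof.
move=> hh hf; apply: (Df_app2 (R := fun x y => x = h y)) => //; first exact: Dfun_var.
exact: Dfun_shift.
Qed.

Lemma Dfun_app2 (h : nat -> nat -> nat) f g :
  Df (fun e => e 0 = h (e 1) (e 2)) -> Dfun f -> Dfun g -> Dfun (fun e => h (f e) (g e)).
Proof.
move=> hh hf hg; apply: (Df_app3 (R := fun x y z => x = h y z)) => //; first exact: Dfun_var.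
  exact: Dfun_shift.
exact: Dfun_shift.
Qed.

Lemma Df_eq f g : Dfun f -> Dfun g -> Df (fun e => f e = g e).
Proof. exact/(Df_app2 (R := fun x y => x = y))/Df_eq_var. Qed.

Lemma Dfun_succ f : Dfun f -> Dfun (fun e => (f e).+1).
Proof.
apply: Dfun_app1; apply: Df_ext
  (Df_and (Df_lt_var 1 0) (Df_not (@Df_ex (fun x e => e 1 < x /\ x < e 0)
     (Df_and (Df_lt_var 2 0) (Df_lt_var 0 1))))) => e /=.
split=> [[h1 h2]|->]; last by split; [|case=> x; lia].
by apply: NNPP => h; apply: h2; exists (e 1).+1; lia.
Qed.

Lemma Dfun_const n : Dfun (fun _ => n).
Proof.
elim: n => [|n IH]; last exact: Dfun_succ.
apply: Df_ext (Df_not (@Df_ex (fun x e => x < e 0) (Df_lt_var 0 1))) => e.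
split=> [h|-> [x]//]; apply: NNPP => h2; apply: h; exists 0; lia.
Qed.

Lemma Df_le f g : Dfun f -> Dfun g -> Df (fun e => f e <= g e).
Proof.
apply: (Df_app2 (R := fun x y => is_true (x <= y))).
by apply: Df_ext (Df_not (Df_lt_var 1 0)) => e; lia.
Qed.

(** Atomic formulas only put a term on the left of [<], so the equation is expressed by saying that
    the term is not below [x] but is below [x + 1]. *)
Lemma Df_term (t : term) : Dfun (teval t).
Proof.
have ht : Df (fun e => teval t (fun i => e i.+1) < e 0).
  by exists (Lt (match t with TVar i => TVar i.+1 | THd i => THd i.+1
               | TDrop i k => TDrop i.+1 k.+1 end) 0) => e; case: t.
have ht' : Df (fun e => teval t (fun i => e i.+2) < e 0).
  by apply: (Df_ren (fun i => if i is j.+1 then j.+2 else 0) ht).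
have h := @Df_ex (fun x e => x = (e 0).+1 /\ teval t (fun i => e i.+1) < x)
   (Df_and (Df_eq (Dfun_var 0) (Dfun_succ (Dfun_var 1))) ht').
apply: Df_ext (Df_and (Df_not ht) h) => e; split=> [[h1 [x [-> h2]]]|->]; first by lia.
by split; [lia | exists (teval t (fun i => e i.+1)).+1; lia].
Qed.

Lemma Dfun_cdrop f g : Dfun f -> Dfun g -> Dfun (fun e => cdrop (f e) (g e)).
Proof. exact/Dfun_app2/(Df_eq (Dfun_var 0))/(Df_term (TDrop 1 2)). Qed.

Lemma Dfun_dec f g : Dfun f -> Dfun g -> Dfun (fun e => dec (f e) (g e)).
Proof.
move=> hf hg.
have -> : (fun e => dec (f e) (g e)) = (fun e => dec (cdrop (g e) (f e)) 0).
  by apply: functional_extensionality => e; rewrite dec_cdrop addn0.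
apply: (Dfun_app1 (h := fun x => dec x 0)); first exact: (Df_eq (Dfun_var 0) (Df_term (THd 1))).
exact: Dfun_cdrop.
Qed.

Lemma Dfun_ccons f g : Dfun f -> Dfun g -> Dfun (fun e => ccons (f e) (g e)).
Proof.
apply: Dfun_app2.
apply: (@Df_ext (fun e => ~ (e 0 = 0) /\ (dec (e 0) 0 = e 1 /\ cdrop 1 (e 0) = e 2))).
  by move=> e; rewrite ccons_eq; split=> [[? []]|[]].
have h0 := Dfun_const 0; have h1 := Dfun_const 1.
have v i := Dfun_var i.
apply: Df_and; first exact/Df_not/Df_eq.
by apply: Df_and; apply: Df_eq => //; [apply: Dfun_dec | apply: Dfun_cdrop].
Qed.

Lemma Df_orc f : Dfun f -> Df (fun e => H (f e)).
Proof. by apply: (Df_app1 (R := fun x => is_true (H x))); exists (Orc 0). Qed.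

Lemma Df_const (P : Prop) : Df (fun _ => P).
Proof.
case: (classic P) => h.
  by apply: Df_ext (Df_eq_var 0 0).
by apply: Df_ext (Df_not (Df_eq_var 0 0)).
Qed.

(** Here [n] is a fixed number and the formulas for the [P i] may be unrelated: the result is a
    finite conjunction. It serves for the chosen families, which are definable one by one and not
    uniformly in their index. *)
Lemma Df_ball n (P : nat -> env -> Prop) :
  (forall i, i < n -> Df (P i)) -> Df (fun e => forall i, i < n -> P i e).
Proof.
elim: n => [|n IH] hP; first by apply: Df_ext (Df_const True) => e.
have hn : Df (fun e => forall i, i < n -> P i e) by apply: IH => i hi; apply: hP; lia.
apply: Df_ext (Df_and hn (hP n (ltnSn n))) => e; split=> [[h1 h2] i hi|h].
  by case: (ltngtP i n) => [/h1 //||->//]; lia.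
by split=> [i hi|]; apply: h; lia.
Qed.

End Definability.

Ltac df1 :=
  cbn beta;
  match goal with
  | |- Dfun _ (fun e => ?n) => apply Dfun_const
  | |- Dfun _ (fun e => S _) => apply Dfun_succ
  | |- Dfun _ (fun e => dec _ _) => apply Dfun_dec
  | |- Dfun _ (fun e => cdrop _ _) => apply Dfun_cdrop
  | |- Dfun _ (fun e => ccons _ _) => apply Dfun_ccons
  | |- Dfun _ (fun e => e _) => apply Dfun_var
  | |- Df _ (fun e => ?P) => apply Df_const
  | |- Df _ (fun e => _ /\ _) => apply Df_and
  | |- Df _ (fun e => _ \/ _) => apply Df_or
  | |- Df _ (fun e => ~ _) => apply Df_not
  | |- Df _ (fun e => _ <-> _) => apply Df_iff
  | |- Df _ (fun e => exists x, _) => apply Df_ex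
  | |- Df _ (fun e => is_true (leq _ _)) => apply Df_le
  | |- Df _ (fun e => @eq nat _ _) => apply Df_eq
  | |- Df _ (fun e => forall x : nat, _) => apply Df_all
  | |- Df _ (fun e => _ -> _) => apply Df_imp
  end.
Ltac df := repeat df1.

(** * Definable sets are computable in a finite jump *)

(** A structured language between formulas and machines: its loops are verified by induction on a
    counter, and program counters appear only in its compilation. *)
Inductive cmd :=
| CSkip
| CInc of nat
| CDec of nat
| CAsk of nat
| CSeq of cmd & cmd
| CWhile of nat & cmd.

Inductive exec (X : natset) : cmd -> (nat -> nat) -> (nat -> nat) -> Prop :=
| ESkip R : exec X CSkip R R
| EInc r R : exec X (CInc r) R (upd R r (R r).+1)
| EDec r R : exec X (CDec r) R (upd R r (R r).-1)
| EAsk r R : exec X (CAsk r) R (upd R r (nat_of_bool (X (R r))))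
| ESeq a b R R1 R2 : exec X a R R1 -> exec X b R1 R2 -> exec X (CSeq a b) R R2
| EWhile0 r c R : R r = 0 -> exec X (CWhile r c) R R
| EWhileS r c R R1 R2 : R r <> 0 -> exec X c R R1 -> exec X (CWhile r c) R1 R2 ->
    exec X (CWhile r c) R R2.

Fixpoint csize (c : cmd) : nat :=
  match c with
  | CSkip => 0
  | CSeq a b => csize a + csize b
  | CWhile _ c => (csize c).+3
  | _ => 1
  end.

(* Machine register 1 is kept at 0, so that [DecJz 1 o] is an unconditional
   jump; the variable [r] of a command lives in register [2 r]. *)
Fixpoint compile (c : cmd) (o : nat) : program :=
  match c with
  | CSkip => [::]
  | CInc r => [:: Inc r.*2]
  | CDec r => [:: DecJz r.*2 o.+1]
  | CAsk r => [:: Ask r.*2]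
  | CSeq a b => compile a o ++ compile b (o + csize a)
  | CWhile r c => [:: DecJz r.*2 (o + (csize c).+3); Inc r.*2] ++
                  compile c o.+2 ++ [:: DecJz 1 o]
  end.

Lemma size_compile c o : size (compile c o) = csize c.
Proof. by elim: c o => //= [a IHa b IHb|r c IH] o; rewrite !size_cat ?IHa ?IHb ?IH /= ?addn1. Qed.

Definition emb (R : nat -> nat) : nat -> nat := fun j => if odd j then 0 else R j./2.

Lemma emb_double R r : emb R r.*2 = R r.
Proof. by rewrite /emb odd_double doubleK. Qed.

Lemma emb_upd R r v : emb (upd R r v) = upd (emb R) r.*2 v.
Proof.
apply: functional_extensionality => j; rewrite /emb /upd.
by case: (eqVneq j r.*2) => [->|h]; rewrite ?odd_double ?doubleK ?eqxx //;
  case: ifP => // ho; case: eqP => // hr; lia.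
Qed.

(** * Correctness of the compilation *)

Definition reach X p (c c' : config) := exists k, iter k (step X p) c = c'.

Lemma reach_refl X p c : reach X p c c. Proof. by exists 0. Qed.

Lemma reach_trans X p c1 c2 c3 : reach X p c1 c2 -> reach X p c2 c3 -> reach X p c1 c3.
Proof. by move=> [k <-] [l <-]; exists (l + k); rewrite iterD. Qed.

Lemma reach_step X p c : reach X p c (step X p c). Proof. by exists 1. Qed.

Lemma fetch (a b : program) i : nth None (map Some (a ++ i :: b)) (size a) = Some i.
Proof. by rewrite map_cat nth_cat size_map ltnn subnn. Qed.

Lemma fetchD (a b : program) j :
  nth None (map Some (a ++ b)) (size a + j) = nth None (map Some b) j.
Proof. by rewrite map_cat nth_cat size_map ltnNge leq_addr addKn. Qed.

Lemma while_exit X a b r c R : R r = 0 ->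
  reach X (a ++ compile (CWhile r c) (size a) ++ b) (size a, emb R)
    (size a + (csize c).+3, emb R).
Proof.
move=> hr; have := reach_step X (a ++ compile (CWhile r c) (size a) ++ b) (size a, emb R).
by rewrite /step /= fetch emb_double hr eqxx.
Qed.

(** The loop test decrements its register; the [Inc] that follows restores it, so the body starts
    from unchanged contents. *)
Lemma while_enter X a b r c R : R r <> 0 ->
  reach X (a ++ compile (CWhile r c) (size a) ++ b) (size a, emb R)
    ((size a).+2, emb R).
Proof.
move=> hr; set p := _ ++ _.
have h1 := reach_step X p (size a, emb R); apply: reach_trans h1 _.
rewrite /step /p /= fetch emb_double; case: eqP => // _.
have := reach_step X p ((size a).+1, upd (emb R) r.*2 (R r).-1).
rewrite /step /p -[in nth _ _ _]addn1 fetchD /=.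
congr (reach _ _ _ (_, _)); apply: functional_extensionality => j; rewrite /upd eqxx.
by case: eqP => [->|//]; rewrite emb_double; lia.
Qed.

Lemma while_back X a b r c R :
  reach X (a ++ compile (CWhile r c) (size a) ++ b) ((size a).+2 + csize c, emb R)
    (size a, emb R).
Proof.
have -> : a ++ compile (CWhile r c) (size a) ++ b =
  (a ++ [:: DecJz r.*2 (size a + (csize c).+3); Inc r.*2] ++ compile c (size a).+2) ++
  DecJz 1 (size a) :: b by rewrite /= -!catA.
set q := _ ++ _; have := reach_step X q ((size a).+2 + csize c, emb R).
rewrite /step /q.
have {2}-> : (size a).+2 + csize c =
  size (a ++ [:: DecJz r.*2 (size a + (csize c).+3); Inc r.*2] ++ compile c (size a).+2).
  by rewrite !size_cat size_compile /=; lia.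
by rewrite fetch.
Qed.

Lemma exec_reach X c R R' : exec X c R R' -> forall a b,
  reach X (a ++ compile c (size a) ++ b) (size a, emb R) (size a + csize c, emb R').
Proof.
elim=> {c R R'} [R|r R|r R|r R|c d R R1 R2 _ IH1 _ IH2|r c R hr|r c R R1 R2 hr _ IH1 _ IH2] a b.
- by rewrite addn0; apply: reach_refl.
- have := reach_step X (a ++ Inc r.*2 :: b) (size a, emb R).
  by rewrite /step fetch emb_double addn1 emb_upd.
- have := reach_step X (a ++ DecJz r.*2 (size a).+1 :: b) (size a, emb R).
  rewrite /step fetch emb_double /= addn1 emb_upd; case: eqP => [hr|//] h.
  suff -> : upd (emb R) r.*2 (R r).-1 = emb R by exact: h.
  apply: functional_extensionality => j; rewrite /upd.
  by case: eqP => [->|//]; rewrite emb_double hr.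
- have := reach_step X (a ++ Ask r.*2 :: b) (size a, emb R).
  by rewrite /step fetch emb_double addn1 emb_upd.
- have := IH1 a (compile d (size a + csize c) ++ b).
  have := IH2 (a ++ compile c (size a)) b.
  rewrite size_cat size_compile /= !catA !addnA => h2 h1; exact: reach_trans h1 h2.
- exact: while_exit.
- apply: reach_trans (while_enter X a b c hr) _.
  set a' := a ++ [:: DecJz r.*2 (size a + (csize c).+3); Inc r.*2].
  have sa' : size a' = (size a).+2 by rewrite size_cat addn2.
  have := IH1 a' ([:: DecJz 1 (size a)] ++ b).
  have -> : a' ++ compile c (size a') ++ [:: DecJz 1 (size a)] ++ b =
            a ++ compile (CWhile r c) (size a) ++ b by rewrite sa' /a' /= -!catA.
  rewrite sa' => h; apply: reach_trans h _.
  apply: reach_trans (while_back X a b r c R1) _; exact: IH2.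
Qed.

Lemma emb_init x : emb (init x).2 = (init x).2.
Proof.
apply: functional_extensionality => j; rewrite /emb /=.
by case: j => [//|j]; case: ifP => // h; case: eqP => //; case: eqP => //=; lia.
Qed.

Lemma exec_run X c x R : exec X c (init x).2 R ->
  exists k, run X (compile c 0) k x = (csize c, emb R).
Proof. by move/exec_reach/(_ [::] [::]); rewrite cats0 emb_init. Qed.

Lemma halted_stable X p (c : config) k : size p <= c.1 -> iter k (step X p) c = c.
Proof.
case: c => pc R h; elim: k => //= k ->; rewrite /step nth_default // size_map //.
Qed.

Lemma halts_exec X c x R : exec X c (init x).2 R -> halts X (compile c 0) x.
Proof. by case/exec_run=> k h; exists k; rewrite h size_compile. Qed.

(** Under the invariant the machine keeps returning to the head of the loop, each time after at
    least one step, hence at arbitrarily late times. A halted configuration would never change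
    again. *)
Lemma not_halts_while X c0 r c x R0 (Inv : (nat -> nat) -> Prop) :
  exec X c0 (init x).2 R0 -> Inv R0 ->
  (forall R, Inv R -> R r <> 0 /\ exists2 R', exec X c R R' & Inv R') ->
  ~ halts X (compile (CSeq c0 (CWhile r c)) 0) x.
Proof.
move=> h0 i0 hI; set p := compile _ _.
have loop R : Inv R -> exists k R', [/\ 0 < k, Inv R' &
    iter k (step X p) (csize c0, emb R) = (csize c0, emb R')].
  move=> /hI [hr [R' hc hR']].
  set a' := compile c0 0 ++ [:: DecJz r.*2 (csize c0 + (csize c).+3); Inc r.*2].
  have sa' : size a' = (csize c0).+2 by rewrite size_cat size_compile addn2.
  have := exec_reach hc a' [:: DecJz 1 (csize c0)].
  have h1 := @while_enter X (compile c0 0) [::] r c R hr.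
  have h2 := @while_back X (compile c0 0) [::] r c R'.
  rewrite /= !cats0 size_compile in h1 h2.
  have -> : a' ++ compile c (size a') ++ [:: DecJz 1 (csize c0)] = p by rewrite sa' /a' -catA.
  rewrite sa'; case=> k hk; case: h1 => k1 hk1; case: h2 => k2 hk2.
  exists (k2 + (k + k1)), R'; split=> //.
    by case: k1 hk1 => [|k1] h; [case: h | ]; lia.
  by rewrite iterD iterD -/p in hk1 hk2 *; rewrite hk1 hk hk2.
have far n : exists k R', [/\ n <= k, Inv R' & run X p k x = (csize c0, emb R')].
  elim: n => [|n [k [R' [hk hR' hrun]]]].
    have [k] := exec_reach h0 [::] (compile (CWhile r c) (csize c0)).
    by rewrite emb_init => hk; exists k, R0.
  have [k' [R2 [hk' hR2 e]]] := loop _ hR'.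
  by exists (k' + k), R2; split=> //; [lia | rewrite /run iterD; rewrite /run in hrun; rewrite hrun].
case=> k hk; have [k' [R' [lek _ e]]] := far k.
have : run X p k' x = run X p k x.
  by rewrite /run -(subnK lek) iterD; apply: halted_stable.
by rewrite e => e2; move: hk; rewrite -e2 size_compile /=; lia.
Qed.

(* The register file holding [R] below [k], the values [vs] from [k] on, and
   0 above: commands working at level [k] use these registers as a stack. *)
Definition st (R : nat -> nat) (k : nat) (vs : seq nat) : nat -> nat :=
  fun i => if i < k then R i else nth 0 vs (i - k).

Lemma st_eq R R' k vs vs' : (forall i, i < k -> R i = R' i) ->
  (forall i, nth 0 vs i = nth 0 vs' i) -> st R k vs = st R' k vs'.
Proof.
by move=> h1 h2; apply: functional_extensionality => i; rewrite /st h2; case: ifP => // /h1.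
Qed.

Lemma st_low R k vs i : i < k -> st R k vs i = R i.
Proof. by rewrite /st => ->. Qed.

Lemma st_high R k vs j : st R k vs (k + j) = nth 0 vs j.
Proof. by rewrite /st ltnNge leq_addr /= addKn. Qed.

Lemma upd_st R k vs j v : upd (st R k vs) (k + j) v = st R k (set_nth 0 vs j v).
Proof.
apply: functional_extensionality => i; rewrite /upd /st nth_set_nth /=.
case: (ltnP i k) => h; first by case: eqP => //; lia.
by case: eqP => [->|h2]; case: eqP => //; lia.
Qed.

Lemma st_push R k v vs : st (st R k [:: v]) k.+1 vs = st R k (v :: vs).
Proof.
apply: functional_extensionality => i; rewrite /st.
case: (ltngtP i k) => h; first by rewrite ltnS ltnW.
  by rewrite ltnS leqNgt h /= subnS; case: (i - k) (subn_gt0 k i) => [|d]; rewrite h.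
by rewrite h ltnS leqnn subnn.
Qed.

Ltac st_tac := apply: st_eq => // -[|[|[|[|[|[|[|?]]]]]]] //=; rewrite ?nth_nil ?addn0 //=.

Lemma exec_eq X c R R1 R2 : exec X c R R1 -> R1 = R2 -> exec X c R R2.
Proof. by move=> h <-. Qed.

Lemma exec_eql X c R R1 R2 : exec X c R1 R2 -> R = R1 -> exec X c R R2.
Proof. by move=> h ->. Qed.

Lemma exec_inc X R k vs j :
  exec X (CInc (k + j)) (st R k vs) (st R k (set_nth 0 vs j (nth 0 vs j).+1)).
Proof. by apply: exec_eq (EInc _ _ _) _; rewrite upd_st st_high. Qed.

Lemma exec_dec X R k vs j :
  exec X (CDec (k + j)) (st R k vs) (st R k (set_nth 0 vs j (nth 0 vs j).-1)).
Proof. by apply: exec_eq (EDec _ _ _) _; rewrite upd_st st_high. Qed.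

Lemma exec_for X r c (I : nat -> nat -> nat) n : (forall m, I m r = m) ->
  (forall m, m < n -> exec X c (I m.+1) (I m)) -> exec X (CWhile r c) (I n) (I 0).
Proof.
move=> hr; elim: n => [|n IH] h; first exact: EWhile0.
apply: EWhileS (h n _) (IH _) => //; first by rewrite hr.
by move=> m hm; apply: h; lia.
Qed.

Lemma exec_forst X R k j c (I : nat -> seq nat) n : (forall m, nth 0 (I m) j = m) ->
  (forall m, m < n -> exec X c (st R k (I m.+1)) (st R k (I m))) ->
  exec X (CWhile (k + j) c) (st R k (I n)) (st R k (I 0)).
Proof. by move=> h1 h2; apply: (exec_for (I := fun m => st R k (I m))) => // m; rewrite st_high. Qed.

(** * Commands for arithmetic and for sequence codes *)

Definition CMove a b := CWhile a (CSeq (CDec a) (CInc b)).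
Definition CClear a := CWhile a (CDec a).
Definition CCopy a b c := CSeq (CWhile a (CSeq (CDec a) (CSeq (CInc b) (CInc c)))) (CMove c a).

Lemma exec_move X a b R : a <> b -> exec X (CMove a b) R (upd (upd R b (R b + R a)) a 0).
Proof.
move=> hab.
have := @exec_for X a (CSeq (CDec a) (CInc b)) (fun m => upd (upd R b (R b + (R a - m))) a m) (R a).
rewrite subn0 subnn addn0 => h; apply: exec_eql (h _ _) _.
- by move=> m; rewrite /upd eqxx.
- move=> m hm; apply: ESeq (EDec _ _ _) _; apply: exec_eq (EInc _ _ _) _.
  apply: functional_extensionality => i; rewrite /upd !eqxx.
  by repeat (case: eqP => //= ?; subst => //); lia.
- apply: functional_extensionality => i; rewrite /upd.
  by case: eqP => [->//|_]; case: eqP => [->|].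
Qed.

Lemma exec_movest X R k i j vs : i <> j -> exec X (CMove (k + i) (k + j)) (st R k vs)
  (st R k (set_nth 0 (set_nth 0 vs j (nth 0 vs j + nth 0 vs i)) i 0)).
Proof.
move=> h; have hk : k + i <> k + j by lia.
by apply: exec_eq (exec_move _ _ hk) _; rewrite !st_high !upd_st.
Qed.

Lemma exec_clear X a R : exec X (CClear a) R (upd R a 0).
Proof.
have := @exec_for X a (CDec a) (fun m => upd R a m) (R a) => h; apply: exec_eql (h _ _) _.
- by move=> m; rewrite /upd eqxx.
- move=> m hm; apply: exec_eq (EDec _ _ _) _; apply: functional_extensionality => i.
  by rewrite /upd eqxx; case: eqP.
- by apply: functional_extensionality => i; rewrite /upd; case: eqP => [->|].
Qed.

Lemma exec_clearst X R k j vs : exec X (CClear (k + j)) (st R k vs) (st R k (set_nth 0 vs j 0)).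
Proof. by apply: exec_eq (exec_clear _ _ _) _; rewrite upd_st. Qed.

Lemma exec_copy X a b c R : a <> b -> a <> c -> b <> c -> R c = 0 ->
  exec X (CCopy a b c) R (upd R b (R b + R a)).
Proof.
move=> ab ac bc Rc; apply: (@ESeq _ _ _ _ (upd (upd (upd R b (R b + R a)) c (R a)) a 0)).
  have := @exec_for X a (CSeq (CDec a) (CSeq (CInc b) (CInc c)))
    (fun m => upd (upd (upd R b (R b + (R a - m))) c (R a - m)) a m) (R a).
  rewrite subn0 subnn addn0 => h; apply: exec_eql (h _ _) _.
  - by move=> m; rewrite /upd eqxx.
  - move=> m hm; apply: ESeq (EDec _ _ _) _; apply: ESeq (EInc _ _ _) _.
    apply: exec_eq (EInc _ _ _) _.
    apply: functional_extensionality => i; rewrite /upd !eqxx.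
    by repeat (case: eqP => //= ?; subst => //); lia.
  - apply: functional_extensionality => i; rewrite /upd.
    by repeat (case: eqP => //= ?; subst => //).
apply: exec_eq (exec_move _ _ (not_eq_sym ac)) _.
apply: functional_extensionality => i; rewrite /upd !eqxx.
by repeat (case: eqP => //= ?; subst => //).
Qed.

Lemma exec_copylow X R k i j l vs : i < k -> j <> l -> nth 0 vs l = 0 ->
  exec X (CCopy i (k + j) (k + l)) (st R k vs) (st R k (set_nth 0 vs j (nth 0 vs j + R i))).
Proof.
move=> ik jl hl; have h := @exec_copy X i (k + j) (k + l) (st R k vs).
apply: exec_eq (h _ _ _ _) _; rewrite ?st_high ?upd_st ?st_low //; lia.
Qed.

Definition CDouble a b := CWhile a (CSeq (CDec a) (CSeq (CInc b) (CInc b))).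

Lemma exec_double X R k i j vs : i <> j -> exec X (CDouble (k + i) (k + j)) (st R k vs)
  (st R k (set_nth 0 (set_nth 0 vs j (nth 0 vs j + (nth 0 vs i).*2)) i 0)).
Proof.
move=> hij.
have := @exec_forst X R k i (CSeq (CDec (k + i)) (CSeq (CInc (k + j)) (CInc (k + j))))
  (fun m => set_nth 0 (set_nth 0 vs j (nth 0 vs j + (nth 0 vs i - m).*2)) i m) (nth 0 vs i).
rewrite subn0 => h; apply: exec_eql (h _ _) _.
- by move=> m; rewrite nth_set_nth /= eqxx.
- move=> m hm; apply: ESeq (exec_dec _ _ _ _ _) _; apply: ESeq (exec_inc _ _ _ _ _) _.
  apply: exec_eq (exec_inc _ _ _ _ _) _; apply: st_eq => // l.
  have [ij ji] : (i == j) = false /\ (j == i) = false by split; apply/eqP; lia.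
  rewrite !(nth_set_nth, eqxx, ij, ji) /= !(nth_set_nth, eqxx, ij, ji) /=.
  case: (eqVneq l j) => [->|lj]; rewrite !(nth_set_nth, eqxx, ij, ji) /=; last first.
    by case: ifP => // li; rewrite nth_set_nth /= li nth_set_nth /= (negPf lj).
  by rewrite !(nth_set_nth, eqxx, ij, ji) /=; lia.
- apply: st_eq => // l; rewrite subnn addn0 !nth_set_nth /=.
  by case: eqP => [->//|_]; rewrite nth_set_nth /=; case: eqP => [->|].
Qed.

(** The code of a sequence with head [a] and tail code [b] is [2 ^ a * (2 * b + 1)]: the command
    forms the odd factor and then doubles it [a] times. *)
Definition CCons k :=
  CSeq (CDouble (k + 1) (k + 2)) (CSeq (CInc (k + 2))
  (CSeq (CWhile (k + 0) (CSeq (CDec (k + 0))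
     (CSeq (CDouble (k + 2) (k + 1)) (CMove (k + 1) (k + 2)))))
  (CMove (k + 2) (k + 0)))).

Lemma cconsE a b : ccons a b = 2 ^ a * (b.*2.+1).
Proof. by rewrite /ccons /= -/CodeSeq.code CodeSeq.decodeK. Qed.

Lemma exec_cons X R k a b : exec X (CCons k) (st R k [:: a; b]) (st R k [:: ccons a b]).
Proof.
rewrite cconsE.
apply: ESeq (exec_double _ _ _ _ _) _ => //=; apply: ESeq (exec_inc _ _ _ _ _) _ => /=.
apply: (@ESeq _ _ _ _ (st R k [:: 0; 0; 2 ^ a * b.*2.+1])); last first.
  apply: exec_eq (exec_movest _ _ _ _ _) _ => //=; st_tac.
have := @exec_forst X R k 0 (CSeq (CDec (k + 0))
     (CSeq (CDouble (k + 2) (k + 1)) (CMove (k + 1) (k + 2))))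
  (fun m => [:: m; 0; 2 ^ (a - m) * b.*2.+1]) a.
rewrite subn0 subnn mul1n => h; apply: h => // m hm.
apply: ESeq (exec_dec _ _ _ _ _) _ => /=; apply: ESeq (exec_double _ _ _ _ _) _ => //=.
apply: exec_eq (exec_movest _ _ _ _ _) _ => //=; congr (st R k [:: _; _; _]).
by rewrite add0n (_ : a - m = (a - m.+1).+1) ?expnS; lia.
Qed.

Definition CSign a b := CWhile a (CSeq (CClear a) (CInc b)).

Lemma exec_sign X R k i j vs : i <> j -> exec X (CSign (k + i) (k + j)) (st R k vs)
  (st R k (set_nth 0 (set_nth 0 vs i 0) j (nth 0 vs j + (nth 0 vs i != 0)))).
Proof.
move=> ij; case: (nth 0 vs i =P 0) => h /=.
  apply: exec_eq (EWhile0 _ _ _) _; first by rewrite st_high.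
  apply: st_eq => // l; rewrite !nth_set_nth /= addn0.
  by case: eqP => [->//|_]; rewrite nth_set_nth /=; case: eqP => [->|].
apply: (@EWhileS _ _ _ _ (st R k (set_nth 0 (set_nth 0 vs i 0) j (nth 0 vs j).+1))).
- by rewrite st_high.
- apply: ESeq (exec_clearst _ _ _ _ _) _; apply: exec_eq (exec_inc _ _ _ _ _) _.
  by rewrite nth_set_nth /=; case: eqP => //; lia.
apply: exec_eq (EWhile0 _ _ _) _; last by rewrite addn1.
by rewrite st_high nth_set_nth /=; case: (i =P j) => // _; rewrite nth_set_nth /= eqxx.
Qed.

Lemma exec_uphalf X R k c x y l :
  exec X (CWhile (k + 0) (CSeq (CDec (k + 0)) (CSeq (CDec (k + 0)) (CInc (k + 2)))))
    (st R k [:: c, x, y & l]) (st R k [:: 0, x, y + uphalf c & l]).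
Proof.
have [n] := ubnP c; elim: n c y => // n IH [|c] y hc.
  by apply: exec_eq (EWhile0 _ _ _) _; rewrite ?st_high ?addn0.
apply: (@EWhileS _ _ _ _ (st R k [:: c.-1, x, y.+1 & l])); first by rewrite st_high.
  apply: ESeq (exec_dec _ _ _ _ _) _; apply: ESeq (exec_dec _ _ _ _ _) _.
  by apply: exec_eq (exec_inc _ _ _ _ _) _.
apply: exec_eq (IH _ _ _) _; first by lia.
by have -> : y.+1 + uphalf c.-1 = y + uphalf c.+1 by lia.
Qed.

Definition CDup k :=
  CSeq (CWhile (k + 0) (CSeq (CDec (k + 0)) (CSeq (CInc (k + 1)) (CInc (k + 2)))))
       (CMove (k + 2) (k + 0)).

Lemma exec_dup X R k c l :
  exec X (CDup k) (st R k [:: c, 0, 0 & l]) (st R k [:: c, c, 0 & l]).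
Proof.
apply: (@ESeq _ _ _ _ (st R k [:: 0, c, c & l])); last first.
  exact: exec_eq (exec_movest _ _ _ _ _) _.
have := @exec_forst X R k 0 (CSeq (CDec (k + 0)) (CSeq (CInc (k + 1)) (CInc (k + 2))))
  (fun m => [:: m, c - m, c - m & l]) c.
rewrite subn0 subnn; apply=> // m hm.
apply: ESeq (exec_dec _ _ _ _ _) _; apply: ESeq (exec_inc _ _ _ _ _) _.
by apply: exec_eq (exec_inc _ _ _ _ _) _ => /=; rewrite -!subSn.
Qed.

(* One round on a positive [c]: halve [c] rounding up, count the round in
   register [k + 4] and, when [c] was odd, undo the count and lower the flag
   [k + 5]. *)
Definition CHalve k :=
  CSeq (CDup k)
  (CSeq (CWhile (k + 0) (CSeq (CDec (k + 0)) (CSeq (CDec (k + 0)) (CInc (k + 2)))))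
  (CSeq (CWhile (k + 2)
     (CSeq (CDec (k + 2)) (CSeq (CInc (k + 0)) (CSeq (CInc (k + 3)) (CInc (k + 3))))))
  (CSeq (CWhile (k + 1) (CSeq (CDec (k + 1)) (CDec (k + 3))))
  (CSeq (CInc (k + 4))
  (CWhile (k + 3) (CSeq (CDec (k + 3)) (CSeq (CDec (k + 4)) (CDec (k + 5))))))))).

Lemma exec_halve X R k c n : exec X (CHalve k) (st R k [:: c; 0; 0; 0; n; 1])
  (st R k [:: uphalf c; 0; 0; 0; n + ~~ odd c; nat_of_bool (~~ odd c)]).
Proof.
apply: ESeq (exec_dup _ _ _ _ _) _; apply: ESeq (exec_uphalf _ _ _ _ _ _ _) _; rewrite add0n.
apply: (@ESeq _ _ _ _ (st R k [:: uphalf c; c; 0; (uphalf c).*2; n; 1])).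
  have := @exec_forst X R k 2
    (CSeq (CDec (k + 2)) (CSeq (CInc (k + 0)) (CSeq (CInc (k + 3)) (CInc (k + 3)))))
    (fun m => [:: uphalf c - m; c; m; (uphalf c - m).*2; n; 1]) (uphalf c).
  rewrite subn0 subnn; apply=> // m hm.
  apply: ESeq (exec_dec _ _ _ _ _) _; apply: ESeq (exec_inc _ _ _ _ _) _.
  apply: ESeq (exec_inc _ _ _ _ _) _; apply: exec_eq (exec_inc _ _ _ _ _) _ => /=.
  by congr (st R k [:: _; _; _; _; _; _]); lia.
apply: (@ESeq _ _ _ _ (st R k [:: uphalf c; 0; 0; nat_of_bool (odd c); n; 1])).
  have := @exec_forst X R k 1 (CSeq (CDec (k + 1)) (CDec (k + 3)))
    (fun m => [:: uphalf c; m; 0; odd c + m; n; 1]) c.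
  rewrite addn0 (_ : odd c + c = (uphalf c).*2); last by lia.
  apply=> // m hm.
  by apply: ESeq (exec_dec _ _ _ _ _) _; apply: exec_eq (exec_dec _ _ _ _ _) _ => /=;
    rewrite addnS.
apply: ESeq (exec_inc _ _ _ _ _) _ => /=; case: (odd c) => /=.
  apply: EWhileS; first by rewrite st_high.
    apply: ESeq (exec_dec _ _ _ _ _) _; apply: ESeq (exec_dec _ _ _ _ _) _.
    exact: exec_dec.
  by apply: exec_eq (EWhile0 _ _ _) _; rewrite ?st_high //= addn0.
by apply: exec_eq (EWhile0 _ _ _) _; rewrite ?st_high //= addn1.
Qed.

Lemma exec_halves X R k a b n :
  exec X (CWhile (k + 5) (CHalve k)) (st R k [:: 2 ^ a * b.*2.+1; 0; 0; 0; n; 1])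
    (st R k [:: b.+1; 0; 0; 0; n + a; 0]).
Proof.
elim: a n => [|a IH] n; apply: EWhileS (exec_halve _ _ _ _ _) _; rewrite ?st_high //.
  rewrite mul1n /= odd_double /= doubleK.
  by apply: EWhile0; rewrite st_high.
rewrite expnS -mulnA mul2n odd_double /= uphalf_double addn1.
by apply: exec_eq (IH _) _; rewrite addSnnS.
Qed.

(** On [2 ^ a * (2 * b + 1)] the first [a] halvings are exact and counted; the next one rounds up to
    [b + 1] and lowers the flag, so a final decrement leaves [b]. On the code 0 the flag is never
    raised and both results are 0. *)
Definition CUncons k :=
  CSeq (CDup k) (CSeq (CSign (k + 1) (k + 5)) (CSeq (CWhile (k + 5) (CHalve k))
  (CSeq (CDec (k + 0)) (CSeq (CMove (k + 0) (k + 1)) (CMove (k + 4) (k + 0)))))).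

Lemma exec_uncons X R k c :
  exec X (CUncons k) (st R k [:: c]) (st R k [:: dec c 0; cdrop 1 c]).
Proof.
apply: (exec_eql (R1 := st R k [:: c; 0; 0])); last by st_tac.
apply: ESeq (exec_dup _ _ _ _ _) _.
apply: ESeq (exec_sign _ _ _ _ _) _ => //=.
case: (c =P 0) => [->|hc] /=.
  apply: ESeq (EWhile0 _ _ _) _; first by rewrite st_high.
  apply: ESeq (exec_dec _ _ _ _ _) _; apply: ESeq (exec_movest _ _ _ _ _) _ => //=.
  by apply: exec_eq (exec_movest _ _ _ _ _) _ => //=; st_tac.
have := ccons_eta hc; move: (dec c 0) (cdrop 1 c) => a b ->; rewrite cconsE.
apply: ESeq (exec_halves _ _ _ _ _ _) _.
apply: ESeq (exec_dec _ _ _ _ _) _; apply: ESeq (exec_movest _ _ _ _ _) _ => //=.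
by apply: exec_eq (exec_movest _ _ _ _ _) _ => //=; st_tac.
Qed.

Definition CDrop k :=
  CSeq (CWhile (k + 0) (CSeq (CDec (k + 0)) (CSeq (CUncons k.+1)
     (CSeq (CClear (k + 1)) (CMove (k + 2) (k + 1))))))
  (CMove (k + 1) (k + 0)).

Lemma cdrop_comp i j s : cdrop i (cdrop j s) = cdrop (i + j) s.
Proof. by rewrite /cdrop CodeSeq.codeK drop_drop. Qed.

Lemma cdrop0 s : cdrop 0 s = s.
Proof. by rewrite /cdrop drop0 CodeSeq.decodeK. Qed.

Lemma exec_drop X R k i s : exec X (CDrop k) (st R k [:: i; s]) (st R k [:: cdrop i s]).
Proof.
apply: (@ESeq _ _ _ _ (st R k [:: 0; cdrop i s])); last first.
  by apply: exec_eq (exec_movest _ _ _ _ _) _ => //=; st_tac.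
have := @exec_forst X R k 0 (CSeq (CDec (k + 0)) (CSeq (CUncons k.+1)
     (CSeq (CClear (k + 1)) (CMove (k + 2) (k + 1)))))
  (fun m => [:: m; cdrop (i - m) s]) i.
rewrite subnn subn0 cdrop0; apply=> // m hm.
apply: ESeq (exec_dec _ _ _ _ _) _ => /=; rewrite -st_push.
apply: ESeq (exec_uncons _ _ _ _) _; rewrite st_push.
apply: ESeq (exec_clearst _ _ _ _ _) _; apply: exec_eq (exec_movest _ _ _ _ _) _ => //=.
rewrite add0n cdrop_comp (_ : 1 + (i - m.+1) = i - m); last by lia.
by st_tac.
Qed.

(** * Evaluating formulas by commands *)

Definition Ev X k c (P : env -> Prop) := forall R,
  exec X c (st R k [::]) (st R k [:: nat_of_bool (asbool (P (st R k [::])))]).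

Definition term_bound (t : term) :=
  match t with TVar i => i.+1 | THd i => i.+1 | TDrop i j => (maxn i j).+1 end.

Definition CTerm k (t : term) :=
  match t with
  | TVar i => CCopy i (k + 0) (k + 1)
  | THd i => CSeq (CCopy i (k + 0) (k + 1)) (CSeq (CUncons k) (CClear (k + 1)))
  | TDrop i j => CSeq (CCopy i (k + 0) (k + 2)) (CSeq (CCopy j (k + 1) (k + 2)) (CDrop k))
  end.

Lemma exec_term X R k t : term_bound t <= k ->
  exec X (CTerm k t) (st R k [::]) (st R k [:: teval t (st R k [::])]).
Proof.
case: t => [i|i|i j] /= hk.
- by apply: exec_eq (exec_copylow _ _ _ _ _) _ => //=; rewrite st_low.
- apply: ESeq (exec_copylow _ _ _ _ _) _ => //=.
  apply: ESeq (exec_uncons _ _ _ _) _; apply: exec_eq (exec_clearst _ _ _ _ _) _ => /=.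
  by rewrite st_low //; st_tac.
- apply: ESeq (exec_copylow _ _ _ _ _) _ => //=; first by lia.
  apply: ESeq (exec_copylow _ _ _ _ _) _ => //=; first by lia.
  apply: exec_eq (exec_drop _ _ _ _ _) _; rewrite !st_low //; lia.
Qed.

Lemma ev_lt X k t j : term_bound t <= k -> j < k ->
  exists c, Ev X k c (fun e => teval t e < e j).
Proof.
move=> ht hj.
exists (CSeq (CTerm k t) (CSeq (CCopy j (k + 1) (k + 2))
  (CSeq (CWhile (k + 0) (CSeq (CDec (k + 0)) (CDec (k + 1)))) (CSign (k + 1) (k + 0))))) => R.
apply: ESeq (exec_term _ _ ht) _; set a := teval _ _.
apply: ESeq (exec_copylow _ _ _ _ _) _ => //=; rewrite add0n.
apply: (@ESeq _ _ _ _ (st R k [:: 0; R j - a])).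
  have := @exec_forst X R k 0 (CSeq (CDec (k + 0)) (CDec (k + 1)))
    (fun m => [:: m; R j - (a - m)]) a.
  rewrite subnn !subn0; apply=> // m hm.
  apply: ESeq (exec_dec _ _ _ _ _) _; apply: exec_eq (exec_dec _ _ _ _ _) _ => /=.
  by congr (st R k [:: _; _]); lia.
apply: exec_eq (exec_sign _ _ _ _ _) _ => //=.
rewrite (st_low R [::] hj) add0n subn_eq0 -ltnNge.
have -> : asbool (a < R j) = (a < R j) by apply/asboolP/idP.
by st_tac.
Qed.

Lemma ev_not X k c P : Ev X k c P -> exists c', Ev X k c' (fun e => ~ P e).
Proof.
move=> h; exists (CSeq c (CSeq (CMove (k + 0) (k + 1)) (CSeq (CInc (k + 0))
  (CWhile (k + 1) (CSeq (CDec (k + 1)) (CDec (k + 0))))))) => R.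
apply: ESeq (h R) _; apply: ESeq (exec_movest _ _ _ _ _) _ => //=.
apply: ESeq (exec_inc _ _ _ _ _) _ => /=.
case: (asboolP (P _)) => hP; case: asboolP => hP' //=.
  apply: EWhileS; first by rewrite st_high.
    by apply: ESeq (exec_dec _ _ _ _ _) _; apply: exec_dec.
  by apply: exec_eq (EWhile0 _ _ _) _; rewrite ?st_high //=; st_tac.
by apply: exec_eq (EWhile0 _ _ _) _; rewrite ?st_high //=; st_tac.
Qed.

Lemma ev_and X k c d P Q : Ev X k c P -> Ev X k d Q ->
  exists c', Ev X k c' (fun e => P e /\ Q e).
Proof.
move=> hc hd; exists (CSeq c (CSeq (CWhile (k + 0) (CSeq (CDec (k + 0))
   (CSeq d (CMove (k + 0) (k + 1))))) (CMove (k + 1) (k + 0)))) => R.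
apply: ESeq (hc R) _.
set b := asbool (_ /\ _).
apply: (@ESeq _ _ _ _ (st R k [:: 0; nat_of_bool b])); last first.
  by apply: exec_eq (exec_movest _ _ _ _ _) _ => //=; st_tac.
rewrite /b; case: (asboolP (P _)) => hP /=; last first.
  apply: exec_eq (EWhile0 _ _ _) _; rewrite ?st_high //=.
  by case: asboolP => [[]//|_]; st_tac.
apply: EWhileS; first by rewrite st_high.
  apply: ESeq (exec_dec _ _ _ _ _) _ => /=.
  apply: ESeq; first by apply: exec_eql (hd R) _; st_tac.
  exact: exec_movest.
apply: exec_eq (EWhile0 _ _ _) _; rewrite ?st_high //= add0n.
by do 2![case: asboolP => //]; tauto.
Qed.

Fixpoint CPack k j :=
  if j is j'.+1 then
    CSeq (CSeq (CMove (k + 0) (k + 1)) (CSeq (CCopy j' (k + 0) (k + 2)) (CCons k))) (CPack k j')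
  else CSkip.

Lemma exec_pack X R k j l : j <= k ->
  exec X (CPack k j) (st R k [:: CodeSeq.code l]) (st R k [:: CodeSeq.code (mkseq R j ++ l)]).
Proof.
elim: j l => [|j IH] l hj; first exact: ESkip.
apply: (@ESeq _ _ _ _ (st R k [:: CodeSeq.code (R j :: l)])); last first.
  by apply: exec_eq (IH _ _) _; rewrite ?mkseqS ?cat_rcons //; lia.
apply: ESeq (exec_movest _ _ _ _ _) _ => //.
apply: ESeq (exec_copylow _ _ _ _ _) _ => //.
by apply: exec_eq (exec_cons _ _ _ _ _) _; rewrite /ccons /= CodeSeq.codeK.
Qed.

Fixpoint CUnpack j n := if n is n'.+1 then CSeq (CUncons j) (CUnpack j.+1 n') else CSkip.

Lemma exec_unpack X R j l : exec X (CUnpack j (size l)) (st R j [:: CodeSeq.code l]) (st R j l).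
Proof.
elim: l R j => [|a l IH] R j.
  by apply: exec_eq (ESkip _ _) _; st_tac.
apply: ESeq (exec_uncons _ _ _ _) _; rewrite -st_push -[in X in exec _ _ _ X]st_push.
have -> : dec (CodeSeq.code (a :: l)) 0 = a by rewrite dec_code.
have -> : cdrop 1 (CodeSeq.code (a :: l)) = CodeSeq.code l.
  by rewrite /cdrop CodeSeq.codeK /= drop0.
exact: IH.
Qed.

(** * Unbounded search as a halting problem *)

Section Search.
Variables (X : natset) (k : nat) (c : cmd) (P : env -> Prop).
Hypothesis hc : Ev X k.+1 c (fun e => ~ P e).

(** The input codes the values of [k] variables. Unpacking it into the registers from 1 on frees
    register 0 for the candidate witness, which is variable 0 of [P]; register [k + 1] then holds
    the truth value of the negation of [P] and controls the loop. *)
Definition CLoad := CSeq (CSeq (CMove 0 1) (CUnpack 1 k)) c.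
Definition CLoop := CSeq (CDec (k.+1 + 0)) (CSeq (CInc 0) c).
Definition CSearch := CSeq CLoad (CWhile (k.+1 + 0) CLoop).

Definition sst R y := st (scons y R) k.+1 [::].
Definition sflag R y := st (scons y R) k.+1 [:: nat_of_bool (asbool (~ P (sst R y)))].

Lemma exec_load R : exec X CLoad (init (CodeSeq.code (mkseq R k))).2 (sflag R 0).
Proof.
apply: (@ESeq _ _ _ _ (sst R 0)); last exact: hc.
apply: (@ESeq _ _ _ _ (st (fun=> 0) 1 [:: CodeSeq.code (mkseq R k)])).
  apply: exec_eq (@exec_move _ 0 1 _ _) _ => //.
  apply: functional_extensionality => -[|[|i]] //=.
  by rewrite /upd /st /= nth_nil.
have := exec_unpack X (fun=> 0) 1 (mkseq R k); rewrite size_mkseq => h; apply: exec_eq h _.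
apply: functional_extensionality => -[|i] //=; rewrite /sst /st /= subn1 /=.
case: (ltnP i k) => h; first by rewrite nth_mkseq // ltnS h.
by rewrite ltnS ltnNge h /= nth_nil nth_default ?size_mkseq.
Qed.

Lemma exec_loop R y : exec X CLoop (sflag R y) (sflag R y.+1).
Proof.
apply: ESeq (exec_dec _ _ _ _ _) _ => /=; apply: ESeq (EInc _ _ _) _.
apply: exec_eql (hc (scons y.+1 R)) _; apply: functional_extensionality => -[|i] //.
rewrite /upd /st /= ; case: ifP => // _; rewrite nth_nil; case: (_ - _) => [|i'] /=.
  by case: (asbool _).
by rewrite nth_nil.
Qed.

Lemma sst_scons R y : sst R y = scons y (st R k [::]).
Proof. by apply: functional_extensionality => -[]. Qed.

Lemma halts_search R : halts X (compile CSearch 0) (CodeSeq.code (mkseq R k)) <->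
  exists y, P (scons y (st R k [::])).
Proof.
have flag y : sflag R y (k.+1 + 0) = nat_of_bool (asbool (~ P (sst R y))) by rewrite /sflag st_high.
split=> [h|[y hy]].
  apply: NNPP => hn; apply: (@not_halts_while X CLoad (k.+1 + 0) CLoop _ (sflag R 0)
     (fun R' => exists y, R' = sflag R y)) h.
  - exact: exec_load.
  - by exists 0.
  move=> _ [y ->]; split; last by exists (sflag R y.+1); [apply: exec_loop | exists y.+1].
  by rewrite flag; case: asboolP => // hP; case: hn; exists y; rewrite -sst_scons; apply: NNPP.
suff [R' hR'] : exists R', exec X (CWhile (k.+1 + 0) CLoop) (sflag R 0) R'.
  by apply: halts_exec (ESeq (exec_load R) hR').
rewrite -sst_scons in hy.
suff main n y' : y' + n = y -> exists R', exec X (CWhile (k.+1 + 0) CLoop) (sflag R y') R'.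
  exact: (main y 0).
elim: n y' => [|n IH] y' hn.
  exists (sflag R y'); apply: EWhile0; rewrite flag; case: asboolP => // h.
  by case: h; move: hn; rewrite addn0 => ->.
have [R' hR'] := IH y'.+1 ltac:(lia).
case: (asboolP (~ P (sst R y'))) => h.
  exists R'; apply: EWhileS (exec_loop R y') hR'; rewrite flag.
  by case: asboolP.
by exists (sflag R y'); apply: EWhile0; rewrite flag; case: asboolP.
Qed.

End Search.

Fixpoint CIncs r n := if n is n'.+1 then CSeq (CIncs r n') (CInc r) else CSkip.

Lemma exec_incs X R k n v vs :
  exec X (CIncs (k + 0) n) (st R k (v :: vs)) (st R k (n + v :: vs)).
Proof. by elim: n => [|n IH]; [exact: ESkip | apply: ESeq IH (exec_inc _ _ _ _ _)]. Qed.

Lemma jump_pickle X p x : jump X (pickle (p, x)) = asbool (halts X p x).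
Proof.
rewrite /jump; apply/asboolP/asboolP => [[p' [x' [h hp]]]|h]; last by exists p, x.
by have [<- <-] := pcan_inj pickleK h.
Qed.

(** A witness exists iff the search program [p] halts on the packed variables [x], which is one
    query to the jump. The program is fixed, so its code [N] is a constant produced by [N]
    increments, and two pairings build the code of [(p, x)]. *)
Lemma ev_ex X k c P : Ev X k.+1 c (fun e => ~ P e) ->
  exists c', Ev (jump X) k c' (fun e => exists y, P (scons y e)).
Proof.
move=> hc; have := halts_search hc; move: (compile _ 0) => p hp.
have [N hN] : exists N, N = pickle p by exists (pickle p).
exists (CSeq (CPack k k) (CSeq (CCons k) (CSeq (CMove (k + 0) (k + 1))
  (CSeq (CIncs (k + 0) N) (CSeq (CCons k) (CAsk (k + 0))))))) => R.
apply: ESeq.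
  apply: exec_eql (exec_pack _ _ [::] (leqnn k)) _.
  by st_tac.
rewrite cats0; set x := CodeSeq.code _.
apply: ESeq; first by apply: exec_eql (exec_cons _ _ _ x 0) _; st_tac.
apply: ESeq (exec_movest _ _ _ _ _) _ => //=.
apply: ESeq (exec_incs _ _ _ _ _ _) _; rewrite [N + 0]addn0 add0n.
apply: ESeq (exec_cons _ _ _ _ _) _.
apply: exec_eq (EAsk _ _ _) _; rewrite upd_st st_high /=.
have -> : ccons N (ccons x 0) = pickle (p, x) by rewrite hN /ccons CodeSeq.codeK.
rewrite jump_pickle; congr (st R k [:: nat_of_bool _]).
by apply/asboolP/asboolP; rewrite hp.
Qed.

Definition emptyset : natset := fun _ => false.

(** Each quantifier costs one jump. All larger [n] and [k] are allowed, so that the two members of a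
    conjunction can share an oracle and a stack level. *)
Lemma sat_computable f : exists n0 m, forall n k, n0 <= n -> m <= k ->
  exists c, Ev (njump n emptyset) k c (sat emptyset f).
Proof.
elim: f => [t j|i|f [n0 [m IH]]|f [n0 [m IHf]] g [n1 [m1 IHg]]|f [n0 [m IH]]].
- exists 0, (maxn (term_bound t) j.+1) => n k _; rewrite geq_max => /andP[h1 h2].
  exact: ev_lt.
- exists 0, 0 => n k _ _; exists CSkip => R /=; apply: exec_eq (ESkip _ _) _.
  by case: asboolP => // _; st_tac.
- by exists n0, m => n k h1 h2; have [c hc] := IH n k h1 h2; apply: ev_not hc.
- exists (maxn n0 n1), (maxn m m1) => n k; rewrite !geq_max => /andP[h1 h2] /andP[h3 h4].
  have [c hc] := IHf n k h1 h3; have [d hd] := IHg n k h2 h4; exact: ev_and hc hd.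
- exists n0.+1, m => -[//|n] k h1 h2.
  have [c hc] := IH n k.+1 h1 (leqW h2); have [d hd] := ev_not hc.
  exact: (ev_ex hd).
Qed.

Lemma Df_arithmetical (W : nat -> Prop) :
  Df emptyset (fun e => W (e 0)) -> arithmetical (fun x => asbool (W x)).
Proof.
case=> f hf; have [n0 [m IH]] := sat_computable f.
(* A level of at least 1 keeps the input, in register 0, among the variables. *)
have [c hc] := IH n0 (maxn m 1) (leqnn _) (leq_maxl _ _); set k := maxn m 1 in hc.
exists n0, (compile (CSeq c (CSeq (CClear 0) (CMove k 0))) 0) => x.
have e0 : st (init x).2 k [::] = (init x).2.
  apply: functional_extensionality => i; rewrite /st; case: ltnP => // h.
  by rewrite nth_nil /=; case: eqP => // hi; move: h; rewrite hi /k; lia.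
have h := hc (init x).2; rewrite e0 in h.
have hk0 : k <> 0 by rewrite /k; lia.
have [l hl] := exec_run (ESeq h (ESeq (exec_clear _ 0 _) (@exec_move _ k 0 _ hk0))).
exists l; change (iter n0 jump) with (njump n0); rewrite hl /=; split.
  by rewrite !size_cat /= !size_compile; lia.
rewrite /emb /= /upd /=; case: eqP => [/esym //|_].
case: eqP => // _; rewrite add0n -[X in st _ _ _ X]addn0 st_high /=.
by congr (nat_of_bool _); apply/asboolP/asboolP; rewrite hf.
Qed.

(** * Sets arithmetical in an oracle are definable from it *)

Definition icode (t r j : nat) : nat := ccons t (ccons (ccons r (ccons j 0)) 0).

Lemma pickle_instr i : pickle i =
  match i with Inc r => icode 0 r 0 | DecJz r j => icode 1 r j | Ask r => icode 2 r 0 end.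
Proof. by case: i => [r|r j|r]; rewrite /icode /ccons !CodeSeq.codeK. Qed.

Lemma icode_inj t r j t' r' j' : icode t r j = icode t' r' j' -> [/\ t = t', r = r' & j = j'].
Proof.
move=> h; have ht := congr1 (dec^~ 0) h; have := congr1 (dec^~ 1) h.
rewrite /icode !dec_ccons /= in ht * => h1.
have hr := congr1 (dec^~ 0) h1; have hj := congr1 (dec^~ 1) h1.
by rewrite !dec_ccons in hr hj.
Qed.

Lemma dec_program (p : program) n : dec (pickle p) n = nth 0 (map pickle p) n.
Proof. exact: dec_code. Qed.

Lemma cdrop_program (p : program) n : cdrop n (pickle p) = 0 <-> size p <= n.
Proof.
rewrite cdrop_eq0 (_ : CodeSeq.decode (pickle p) = map pickle p) ?size_map //.
exact: CodeSeq.codeK.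
Qed.

Definition setreg (r v z z' : nat) : Prop :=
  forall i, (i = r /\ dec z' i.+1 = v) \/ (i <> r /\ dec z' i.+1 = dec z i.+1).

Section Simulation.
Variable X : natset.

(* [z] codes the configuration with program counter [dec z 0] whose register
   [r] holds [dec z r.+1]. *)
Definition StepR (P z z' : nat) : Prop :=
  (cdrop (dec z 0) P = 0 /\ forall i, dec z' i = dec z i) \/
  (cdrop (dec z 0) P <> 0 /\ exists r j,
   (dec P (dec z 0) = icode 0 r 0 /\ dec z' 0 = (dec z 0).+1 /\
      setreg r (dec z r.+1).+1 z z') \/
   (dec P (dec z 0) = icode 1 r j /\ dec z r.+1 = 0 /\ dec z' 0 = j /\
      forall i, dec z' i.+1 = dec z i.+1) \/
   (dec P (dec z 0) = icode 1 r j /\ exists v, dec z r.+1 = v.+1 /\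
      dec z' 0 = (dec z 0).+1 /\ setreg r v z z') \/
   (dec P (dec z 0) = icode 2 r 0 /\ dec z' 0 = (dec z 0).+1 /\
      ((X (dec z r.+1) /\ setreg r 1 z z') \/ (~ X (dec z r.+1) /\ setreg r 0 z z')))).

(** The number [s] codes the history of a run of [k] steps; the program counter is outside the
    program when dropping that many instructions leaves the empty code 0. *)
Definition RunR (P x v : nat) : Prop := exists k s,
  dec s 0 = ccons 0 (ccons x 0) /\ (forall t, t < k -> StepR P (dec s t) (dec s t.+1)) /\
  cdrop (dec (dec s k) 0) P = 0 /\ dec (dec s k) 1 = v.

Definition represents (z : nat) (c : config) := dec z 0 = c.1 /\ forall r, dec z r.+1 = c.2 r.

Lemma setregP r v z z' (R : nat -> nat) : (forall i, dec z i.+1 = R i) ->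
  setreg r v z z' <-> forall i, dec z' i.+1 = upd R r v i.
Proof.
move=> hR; split=> h i; move: (h i); rewrite /upd hR.
  by case=> -[]; [move=> -> ->; rewrite eqxx | case: eqP].
by case: eqP => hi hv; [left | right].
Qed.

Lemma StepRP (p : program) z c z' : represents z c ->
  StepR (pickle p) z z' <-> represents z' (step X p c).
Proof.
case: c => pc R [/= hpc hR]; rewrite /StepR hpc dec_program cdrop_program /step.
case: (leqP (size p) pc) => hp.
  rewrite [nth None _ _]nth_default ?size_map // /represents /=.
  split=> [[[_ h]|[h _]]|[h0 h]]; [|by case: h|].
    by split=> [|r]; rewrite h ?hpc ?hR.
  by left; split=> // -[|i]; rewrite ?h0 ?h ?hpc ?hR.
rewrite !(nth_map (Inc 0)) // pickle_instr.
case: (nth _ p pc) => [r|r j|r].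
- split=> [[[]|[_ [r' [j']]]]|[/= h0 h]]; first by lia.
    case=> [[/icode_inj[_ <- _] [h0]]|[[/icode_inj[]]|[[/icode_inj[]]|[/icode_inj[]]]]] //.
    by rewrite (setregP _ _ _ hR) hR => h; split.
  right; split; first by lia.
  by exists r, 0; left; rewrite (setregP _ _ _ hR) hR.
- split=> [[[]|[_ [r' [j']]]]|]; first by lia.
    case=> [[/icode_inj[]]|[[/icode_inj[_ <- <-]]|[[/icode_inj[_ <- _]]|[/icode_inj[]]]]] //.
      by rewrite hR => -[-> [h0 h]]; split=> //= i; rewrite h.
    case=> v; rewrite hR => -[-> [h0]]; rewrite (setregP _ _ _ hR) => h.
    by split.
  move=> h; right; split; first by lia.
  exists r, j; right; move: h; case: eqP => hr [/= h0 h]; [left | right; left].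
    by split=> //; rewrite hR hr; do ![split=> //] => i; rewrite h hR.
  split=> //; exists (R r).-1; rewrite hR (setregP _ _ _ hR).
  by split=> //; lia.
- split=> [[[]|[_ [r' [j']]]]|[/= h0 h]]; first by lia.
    case=> [[/icode_inj[]]|[[/icode_inj[]]|[[/icode_inj[]]|[/icode_inj[_ <- _] [h0]]]]] //.
    rewrite !(setregP _ _ _ hR) hR => -[] [hX h]; split=> //=.
      by rewrite hX.
    by move/negP/negPf: hX => ->.
  right; split; first by lia.
  exists r, 0; do 3!right; rewrite !(setregP _ _ _ hR) hR; do 2![split=> //].
  by case hX: (X (R r)) h => h; [left | right].
Qed.

Lemma represents_upd z pc R pc' r v : represents z (pc, R) ->
  exists z', represents z' (pc', upd R r v).
Proof.
case=> /= _ hR; exists (CodeSeq.code (pc' :: set_nth 0 (behead (CodeSeq.decode z)) r v)).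
split=> [|i]; rewrite dec_code //=.
by rewrite nth_set_nth /upd /= -hR nth_behead.
Qed.

Lemma represents_step p z c : represents z c -> exists z', represents z' (step X p c).
Proof.
case: c => pc R hz; rewrite /step; case: nth => [[r|r j|r]|]; last by exists z.
- exact: represents_upd hz.
- case: eqP => _; last exact: represents_upd hz.
  case: hz => /= _ hz; exists (ccons j (cdrop 1 z)); split=> [|i].
    by rewrite dec_ccons.
  by rewrite dec_ccons dec_cdrop hz.
- exact: represents_upd hz.
Qed.

Lemma represents_init x : represents (ccons 0 (ccons x 0)) (init x).
Proof.
split=> [|r]; first by rewrite dec_ccons.
rewrite dec_ccons dec_ccons /=; case: r => [//|r] /=.
by rewrite /dec nth_nil.
Qed.

Lemma RunRP (p : program) x v : RunR (pickle p) x v <->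
  exists k, size p <= (run X p k x).1 /\ (run X p k x).2 0 = v.
Proof.
split=> [[k [s [s0 [hs [hk hv]]]]]|[k [hk hv]]].
  have hr t : t <= k -> represents (dec s t) (run X p t x).
    elim: t => [_|t IH ht]; first by rewrite s0; apply: represents_init.
    by apply/(StepRP _ _ (IH (ltnW ht))); apply: hs.
  case: (hr k (leqnn k)) => h0 h; exists k.
  by rewrite -h0 -h; split=> //; apply/cdrop_program.
(* A configuration has many codes, as trailing zeros can be appended; at time 0 the one required by
   [RunR] must be taken. *)
have ex t : exists z, represents z (run X p t x) /\ (t = 0 -> z = ccons 0 (ccons x 0)).
  elim: t => [|t [z [hz _]]]; first by eexists; split; [apply: represents_init|].
  by have [z' hz'] := represents_step p hz; exists z'.
pose g t := proj1_sig (constructive_indefinite_description _ (ex t)).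
have hg t : represents (g t) (run X p t x) /\ (t = 0 -> g t = ccons 0 (ccons x 0)).
  exact: proj2_sig (constructive_indefinite_description _ (ex t)).
have [s hs] := dec_exists g k.+1.
have hs' t : t <= k -> dec s t = g t by move=> ht; rewrite hs ltnS ht.
exists k, s; rewrite !hs' //; case: (hg k) => -[h0 h] _.
split; first by apply: (hg 0).2.
rewrite h0 h cdrop_program; split=> // t ht.
by rewrite !hs' ?(ltnW ht) //; apply/(StepRP p _ (hg t).1); apply: (hg t.+1).1.
Qed.

(** Singles out the codes of programs among all numbers, over which the quantifiers of formulas
    range. *)
Definition ValidR (P : nat) : Prop := forall i, cdrop i P <> 0 -> exists r j,
  dec P i = icode 0 r 0 \/ dec P i = icode 1 r j \/ dec P i = icode 2 r 0.

Lemma ValidRP P : ValidR P <-> exists p : program, pickle p = P.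
Proof.
split=> [h|[p <-] i]; last first.
  rewrite cdrop_program => /negP; rewrite -ltnNge => hi.
  rewrite dec_program (nth_map (Inc 0)) // pickle_instr.
  by case: nth => [r|r j|r]; [exists r, 0; left | exists r, j; right; left | exists r, 0; right; right].
have {}h i : i < size (CodeSeq.decode P) -> exists c : instr, pickle c = nth 0 (CodeSeq.decode P) i.
  move=> hi; case: (h i) => [/cdrop_eq0|r [j]]; first by lia.
  rewrite /dec; case=> [->|[->|->]]; [exists (Inc r)|exists (DecJz r j)|exists (Ask r)];
    by rewrite pickle_instr.
suff [p hp] : exists p : program, map pickle p = CodeSeq.decode P.
  exists p; rewrite -[P]CodeSeq.decodeK -hp; exact: erefl.
elim: (CodeSeq.decode P) h => [_|a l IH h]; first by exists [::].
have [c hc] := h 0 erefl; have [p hp] := IH (fun i => h i.+1).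
by exists (c :: p); rewrite /= hc hp.
Qed.

Lemma jumpR n : jump X n <-> exists P x v, n = ccons P (ccons x 0) /\ ValidR P /\ RunR P x v.
Proof.
have pk (p : program) x : pickle (p, x) = ccons (pickle p) (ccons x 0).
  by rewrite /ccons CodeSeq.codeK.
split=> [/asboolP[p [x [<- [k hk]]]]|[P [x [v [-> [/ValidRP[p <-] /RunRP[k [hk _]]]]]]]].
  exists (pickle p), x, ((run X p k x).2 0); rewrite pk; split=> //.
  by split; [apply/ValidRP; exists p | apply/RunRP; exists k].
by apply/asboolP; exists p, x; rewrite pk; split=> //; exists k.
Qed.

Variable H : natset.
Hypothesis hX : Df H (fun e => X (e 0)).

Lemma Df_RunR f g h : Dfun H f -> Dfun H g -> Dfun H h -> Df H (fun e => RunR (f e) (g e) (h e)).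
Proof.
apply: Df_app3; rewrite /RunR /StepR /setreg /icode; df.
all: apply: (Df_app1 (R := fun x => X x) hX); df.
Qed.

Lemma Df_jump : Df H (fun e => jump X (e 0)).
Proof.
apply: (Df_ext (fun e => iff_sym (jumpR (e 0)))); rewrite /ValidR /icode; df.
by apply: Df_RunR; df.
Qed.

End Simulation.

Lemma Df_njump H n : Df H (fun e => njump n H (e 0)).
Proof.
elim: n => [|n IH]; last exact: Df_jump.
by apply: Df_orc; df.
Qed.

Lemma arithmetical_in_Df H B : arithmetical_in H B -> Df H (fun e => B (e 0)).
Proof.
case=> n [p hp].
apply: (@Df_ext H (fun e => RunR (njump n H) (pickle p) (e 0) 1)); last first.
  by apply: Df_RunR; df; apply: Df_njump.
move=> e; rewrite RunRP; case: (hp (e 0)) => k [hk hv].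
split=> [[k' [hk' hv']]|hB]; last by exists k; rewrite hv hB.
(* A halted configuration is stable, so any two halting times give the same output. *)
suff e2 : run (njump n H) p k (e 0) = run (njump n H) p k' (e 0).
  by move: hv; rewrite e2 hv'; case: (B _).
have stable l m : size p <= (run (njump n H) p l (e 0)).1 -> l <= m ->
    run (njump n H) p m (e 0) = run (njump n H) p l (e 0).
  by move=> hl lm; rewrite /run -(subnK lm) iterD; apply: halted_stable.
by case: (leqP k k') => h; [rewrite (stable k k') | rewrite (stable k' k) // ltnW].
Qed.

(** * Forcing *)

Definition tcode (t : term) : nat :=
  match t with
  | TVar i => CodeSeq.code [:: 0; i]
  | THd i => CodeSeq.code [:: 1; i]
  | TDrop i j => CodeSeq.code [:: 2; i; j]
  end.

Fixpoint fcode (f : form) : nat :=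
  match f with
  | Lt t j => CodeSeq.code [:: 0; tcode t; j]
  | Orc i => CodeSeq.code [:: 1; i]
  | Not f => CodeSeq.code [:: 2; fcode f]
  | And f g => CodeSeq.code [:: 3; fcode f; fcode g]
  | Ex f => CodeSeq.code [:: 4; fcode f]
  end.

Lemma tcode_inj : injective tcode.
Proof. by case=> [i|i|i j] [i'|i'|i' j'] /(can_inj CodeSeq.codeK) // [] => [->|->|-> ->]. Qed.

Lemma fcode_inj : injective fcode.
Proof.
elim=> [t i|i|f IH|f IHf g IHg|f IH] [t' i'|i'|f'|f' g'|f'] /(can_inj CodeSeq.codeK) // [].
- by move=> /tcode_inj -> ->.
- by move=> ->.
- by move/IH->.
- by move=> /IHf -> /IHg ->.
- by move/IH->.
Qed.

Lemma fcode_Not f : fcode f < fcode (Not f).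
Proof. by have /= /and3P[] := CodeSeq.ltn_code [:: 2; fcode f]. Qed.

Lemma fcode_And f g : fcode f < fcode (And f g) /\ fcode g < fcode (And f g).
Proof. by have /= /and4P[] := CodeSeq.ltn_code [:: 3; fcode f; fcode g]. Qed.

Lemma fcode_Ex f : fcode f < fcode (Ex f).
Proof. by have /= /and3P[] := CodeSeq.ltn_code [:: 4; fcode f]. Qed.

(** The new elements may lie anywhere in [Y], also below elements of [s]: a finite set records only
    positive information. *)
Definition ext (s t : nat) (Y : nat -> Prop) : Prop :=
  (forall v, dec s v <> 0 -> dec t v <> 0) /\ (forall v, dec t v <> 0 -> dec s v <> 0 \/ Y v).

(* [t] codes the finite set [{v | dec t v <> 0}] and [E] the environment [dec E].
   Only the clause for [Not] looks at the families [S]; no reservoir occurs, so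
   the relation is arithmetical when the families are. *)
Fixpoint forces (S : nat -> nat -> Prop) (f : form) (t E : nat) : Prop :=
  match f with
  | Lt u j => teval u (dec E) < dec E j
  | Orc i => dec t (dec E i) <> 0
  | Not f => ~ S (fcode f) (ccons t E)
  | And f g => forces S f t E /\ forces S g t E
  | Ex f => exists v, forces S f t (ccons v E)
  end.

(* The index [i = ccons s E] codes a finite set [s] and an environment [E]. *)
Definition cls S f (i : nat) (Y : nat -> Prop) : Prop :=
  exists t, ext (dec i 0) t Y /\ forces S f t (cdrop 1 i).

(** * Largeness and the greedy choice of classes *)

Definition part (c : nat -> nat) (q N m : nat) : nat -> Prop :=
  fun v => N <= v /\ v < m /\ c v = q.

(** The finitary form of largeness: colourings of an interval, coded by [s], replace those of a
    whole final segment, so that only numbers are quantified. The parameter [M] bounds the finite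
    subcollection under consideration. *)
Definition large (Q : nat -> (nat -> Prop) -> Prop) : Prop :=
  forall M N k, exists m, forall s, (forall v, v < m -> dec s v < k) ->
    exists q, q < k /\ Q M (part (dec s) q N m).

Definition base (S : nat -> nat -> Prop) n M (Y : nat -> Prop) : Prop :=
  forall j, j < n -> forall i, i < M -> S j i -> forall f, fcode f = j -> cls S f i Y.

Definition addable S f (D : nat -> Prop) (i : nat) : Prop :=
  large (fun M Y => base S (fcode f) M Y /\ (forall l, l < i -> D l -> cls S f l Y) /\ cls S f i Y).

(** A recursion on [i] made first-order: [s] codes the sequence of decisions up to [i]. *)
Definition greedy (T : (nat -> Prop) -> nat -> Prop) (i : nat) : Prop :=
  exists s, dec s i <> 0 /\
    forall j, j <= i -> (dec s j <> 0 <-> T (fun l => dec s l <> 0) j).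

(** By locality of [T], correct sequences of decisions can be prolonged one step at a time, and any
    two of them agree where both are correct. *)
Lemma greedyP (T : (nat -> Prop) -> nat -> Prop) :
  (forall D D' i, (forall l, l < i -> (D l <-> D' l)) -> T D i -> T D' i) ->
  forall i, greedy T i <-> T (greedy T) i.
Proof.
move=> loc.
pose good s i := forall j, j <= i -> (dec s j <> 0 <-> T (fun l => dec s l <> 0) j).
have ex i : exists s, good s i.
  have step s n : (forall j, j < n -> (dec s j <> 0 <-> T (fun l => dec s l <> 0) j)) ->
      exists s', good s' n.
    move=> hs; pose b := asbool (T (fun l => dec s l <> 0) n).
    have [s' hs'] := dec_exists (fun l => if l == n then nat_of_bool b else dec s l) n.+1.
    have agree l : l < n -> (dec s' l <> 0 <-> dec s l <> 0).
      by move=> hl; rewrite hs' ltnS (ltnW hl); case: eqP => //; lia.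
    have agree' l : l < n -> (dec s l <> 0 <-> dec s' l <> 0).
      by move=> hl; split=> h; apply/agree.
    exists s' => j; rewrite leq_eqVlt => /orP[/eqP ->|hj]; last first.
      rewrite agree // hs //.
      by split; apply: loc => l hl; [apply: agree' | apply: agree]; lia.
    rewrite hs' ltnSn eqxx.
    have -> : (nat_of_bool b <> 0) <-> T (fun l => dec s l <> 0) n.
      by rewrite /b; case: asboolP.
    by split; apply: loc => l hl; [apply: agree' | apply: agree].
  elim: i => [|i [s hs]]; first by apply: (step 0).
  by apply: (step s).
have uniq s s' i i' : good s i -> good s' i' -> forall j, j <= i -> j <= i' ->
    (dec s j <> 0 <-> dec s' j <> 0).
  move=> hs hs' j; have [n] := ubnP j; elim: n j => // n IH j hn h1 h2.
  rewrite hs // hs' //; split; apply: loc => l hl; [|symmetry]; apply: IH; lia.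
have gE s i : good s i -> forall j, j <= i -> (greedy T j <-> dec s j <> 0).
  move=> hs j hj; split=> [[s' [h hs']]|h]; first by apply/(uniq s s' i j).
  by exists s; split=> // l hl; apply: hs; lia.
move=> i; have [s hs] := ex i; rewrite (gE s i) // hs //.
by split; apply: loc => l hl; [symmetry|]; apply: gE hs _ _; lia.
Qed.

Definition stage S (n i : nat) : Prop := exists f, fcode f = n /\ greedy (addable S f) i.

(* Families are built along [fcode], under which subformulas come first, so that
   [forces] for the formula of code [n] only consults families below [n]. *)
Fixpoint stages (n : nat) : nat -> nat -> Prop :=
  if n is n'.+1 then fun j i => if j == n' then stage (stages n') n' i else stages n' j i
  else fun _ _ => False.

Definition chosen (j i : nat) : Prop := stage (stages j) j i.

Lemma stages_chosen n j i : j < n -> stages n j i = chosen j i.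
Proof.
elim: n => // n IH hj /=; case: eqP => [->//|h]; apply: IH; lia.
Qed.

Lemma forces_local S S' f n : (forall j i, j < n -> S j i = S' j i) -> fcode f <= n ->
  forall t E, forces S f t E = forces S' f t E.
Proof.
move=> h; elim: f => [u j|i|f IH|f IHf g IHg|f IH] hn t E //=.
- by rewrite h // (leq_trans (fcode_Not f)).
- by have [h1 h2] := fcode_And f g; rewrite IHf ?IHg //; lia.
- apply: propositional_extensionality; have h1 := fcode_Ex f.
  have hf : fcode f <= n by apply: leq_trans hn; apply: ltnW.
  by split=> -[v hv]; exists v; move: hv; rewrite IH.
Qed.

Lemma cls_local S S' f n : (forall j i, j < n -> S j i = S' j i) -> fcode f <= n ->
  cls S f = cls S' f.
Proof.
move=> h hn; apply: functional_extensionality => i; apply: functional_extensionality => Y.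
apply: propositional_extensionality.
by split=> -[t [h1 h2]]; exists t; move: h2; rewrite (forces_local h hn).
Qed.

Lemma base_local S S' n : (forall j i, j < n -> S j i = S' j i) -> base S n = base S' n.
Proof.
move=> h; apply: functional_extensionality => M; apply: functional_extensionality => Y.
apply: propositional_extensionality.
split=> hb j hj i hi hS f hf; [rewrite -(@cls_local S S' f n) | rewrite (@cls_local S S' f n)];
  rewrite ?hf // ?(ltnW hj) //; apply: (hb j) => //.
  by rewrite h.
by rewrite -h.
Qed.

(** The recursion defining the families, with the truncations [stages] replaced by [chosen] itself:
    forcing and [base] only look at families of smaller code. *)
Lemma chosenP f i : chosen (fcode f) i <-> addable chosen f (chosen (fcode f)) i.
Proof.
have agree j i' : j < fcode f -> stages (fcode f) j i' = chosen j i' by apply: stages_chosen.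
have e : addable (stages (fcode f)) f = addable chosen f.
  apply: functional_extensionality => D; apply: functional_extensionality => i'.
  by rewrite /addable (cls_local agree (leqnn _)) (base_local agree).
have g : chosen (fcode f) = greedy (addable chosen f).
  apply: functional_extensionality => i'; apply: propositional_extensionality.
  rewrite /chosen /stage; split=> [[f' [/fcode_inj ->]]|h]; first by rewrite e.
  by exists f; rewrite e.
rewrite g; apply: greedyP => D D' {}i hD h M N k; have [m hm] := h M N k.
exists m => s /hm [q [hq [h1 [h2 h3]]]]; exists q; do 2!split=> //.
by split=> // l hl hDl; apply: h2 => //; apply/hD.
Qed.

(** * Each family of chosen classes is arithmetical *)

Section Arithmetical.
Let H := emptyset.

Lemma Df_forces S f : (forall j, Df H (fun e => S j (e 0))) ->
  Df H (fun e => forces S f (e 0) (e 1)).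
Proof.
move=> hS; elim: f => [u j|i|f IH|f IHf g IHg|f IH] /=; try by df.
- apply: (Df_le (f := fun e => (teval u (dec (e 1))).+1)); last by df.
  by apply: Dfun_succ; case: u => * /=; df.
- by apply/Df_not/(Df_app1 (hS (fcode f))); df.
- by df; apply: (Df_app2 IH); df.
Qed.

Lemma Df_cls S f : (forall j, Df H (fun e => S j (e 0))) ->
  Df H (fun e => cls S f (e 0) (part (dec (e 1)) (e 2) (e 3) (e 4))).
Proof.
move=> hS; rewrite /cls /ext /part; df.
by apply: (Df_app2 (Df_forces f hS)); df.
Qed.

Lemma Df_app5 (R : nat -> nat -> nat -> nat -> nat -> Prop) f0 f1 f2 f3 f4 :
  Df H (fun e => R (e 0) (e 1) (e 2) (e 3) (e 4)) ->
  Dfun H f0 -> Dfun H f1 -> Dfun H f2 -> Dfun H f3 -> Dfun H f4 ->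
  Df H (fun e => R (f0 e) (f1 e) (f2 e) (f3 e) (f4 e)).
Proof.
move=> hR h0 h1 h2 h3 h4.
apply: (Df_subst (t := fun n => match n with 0 => f0 | 1 => f1 | 2 => f2 | 3 => f3 | _ => f4 end) hR).
by case=> [|[|[|[|]]]].
Qed.

Lemma Df_base S n : (forall j, Df H (fun e => S j (e 0))) ->
  Df H (fun e => base S n (e 0) (part (dec (e 1)) (e 2) (e 3) (e 4))).
Proof.
move=> hS; apply: Df_ball => j hj; df; first by apply: (Df_app1 (hS j)); df.
case: (classic (exists g, fcode g = j)) => [[g hg]|h]; last first.
  by apply: Df_ext (Df_const _ True) => e; split=> // _ g hg; case: h; exists g.
apply: (@Df_ext H (fun e => cls S g (e 0) (part (dec (e 2)) (e 3) (e 4) (e 5)))).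
  move=> e; split=> [h g' hg'|h]; last exact: h.
  by rewrite (@fcode_inj g' g) // hg' hg.
by apply: (Df_app5 (R := fun i s q N m => cls S g i (part (dec s) q N m)) (Df_cls g hS)); df.
Qed.

Lemma Df_greedy T : Df H (fun e => T (fun l => dec (e 0) l <> 0) (e 1)) ->
  Df H (fun e => greedy T (e 0)).
Proof.
move=> hT; rewrite /greedy; df.
by apply: (Df_app2 (R := fun s j => T (fun l => dec s l <> 0) j) hT); df.
Qed.

Lemma Df_addable S f : (forall j, Df H (fun e => S j (e 0))) ->
  Df H (fun e => addable S f (fun l => dec (e 0) l <> 0) (e 1)).
Proof.
move=> hS; rewrite /addable /large; df.
- by apply: (Df_app5 (R := fun i s q N m => base S _ i (part (dec s) q N m)) (Df_base _ hS)); df.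
- by apply: (Df_app5 (R := fun i s q N m => cls S f i (part (dec s) q N m)) (Df_cls f hS)); df.
- by apply: (Df_app5 (R := fun i s q N m => cls S f i (part (dec s) q N m)) (Df_cls f hS)); df.
Qed.

(** The defining formula grows with [n]. This is enough, since the diagonalization against one
    formula involves a single family. *)
Lemma Df_stages n j : Df H (fun e => stages n j (e 0)).
Proof.
elim: n j => [|n IH] j /=; first by df.
case: eqP => [_|//]; rewrite /stage.
case: (classic (exists g, fcode g = n)) => [[g hg]|h]; last first.
  by apply: Df_ext (Df_const _ False) => e; split=> // -[g [hg _]]; case: h; exists g.
apply: Df_ext (Df_greedy (Df_addable g IH)) => e.
by split=> [h|[g' [hg']]]; [exists g | rewrite (@fcode_inj g' g) // hg' hg].
Qed.

Lemma Df_chosen j : Df H (fun e => chosen j (e 0)).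
Proof.
by apply: Df_ext (Df_stages j.+1 j) => e; rewrite stages_chosen.
Qed.

End Arithmetical.

(** * Open classes and compactness *)

Definition upclosed (P : (nat -> Prop) -> Prop) :=
  forall Y Y', (forall v, Y v -> Y' v : Prop) -> P Y -> P Y'.
Definition fchar (P : (nat -> Prop) -> Prop) :=
  upclosed P /\ forall Y, P Y -> exists m, P (fun v => Y v /\ v < m).

Lemma fchar_and P Q : fchar P -> fchar Q -> fchar (fun Y => P Y /\ Q Y).
Proof.
move=> [uP fP] [uQ fQ]; split=> [Y Y' s [h1 h2]|Y [/fP[m hm] /fQ[m' hm']]].
  by split; [apply: uP h1 | apply: uQ h2].
exists (maxn m m'); split; [apply: uP hm | apply: uQ hm'] => v [? ?]; split=> //; lia.
Qed.

Lemma fchar_imp (A : Prop) P : fchar P -> fchar (fun Y => A -> P Y).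
Proof.
move=> [uP fP]; split=> [Y Y' s h hA|Y h]; first exact: uP (h hA).
by case: (classic A) => [/h/fP[m hm]|hA]; [exists m | exists 0].
Qed.

Lemma fchar_ball n (P : nat -> (nat -> Prop) -> Prop) :
  (forall i, fchar (P i)) -> fchar (fun Y => forall i, i < n -> P i Y).
Proof.
move=> h; split=> [Y Y' s hP i hi|Y]; first exact: (h i).1 _ _ s (hP i hi).
elim: n => [|n IH] hP; first by exists 0.
have [m hm] := IH (fun i hi => hP i (leqW hi)); have [m' hm'] := (h n).2 _ (hP n (ltnSn n)).
exists (maxn m m') => i; rewrite ltnS leq_eqVlt => /orP[/eqP ->|hi].
  by apply: (h n).1 hm' => v [? ?]; split=> //; lia.
by apply: (h i).1 (hm i hi) => v [? ?]; split=> //; lia.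
Qed.

Lemma fchar_cls S f i : fchar (cls S f i).
Proof.
split=> [Y Y' s [t [[h1 h2] h3]]|Y [t [[h1 h2] h3]]].
  exists t; split=> //; split=> // v /h2[]; [by left | by move/s; right].
exists (size (CodeSeq.decode t)), t; split=> //; split=> // v hv.
case: (h2 v hv); [by left | right; split=> //].
by rewrite ltnNge; apply/negP => h; apply: hv; rewrite /dec nth_default.
Qed.

Lemma fchar_base S n M : fchar (base S n M).
Proof.
apply: fchar_ball => j; apply: fchar_ball => i; apply: fchar_imp.
case: (classic (exists g, fcode g = j)) => [[g hg]|h]; last first.
  by split=> [Y Y' _ _ f hf|Y _]; [case: h; exists f | exists 0 => f hf; case: h; exists f].
suff -> : (fun Y => forall f, fcode f = j -> cls S f i Y) = cls S g i by apply: fchar_cls.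
apply: functional_extensionality => Y; apply: propositional_extensionality.
by split=> [h|h f hf]; [apply: h | rewrite (@fcode_inj f g) // hf hg].
Qed.

(** König's lemma: [inf n f] says that infinitely many of the given colourings agree with [f] below
    [n], and by the pigeonhole principle one of the [k] values at [n] preserves this. *)
Lemma konig k (c : nat -> nat -> nat) : (forall m v, v < m -> c m v < k) ->
  exists d, forall n, exists m, n <= m /\ forall v, v < n -> c m v = d v.
Proof.
move=> hc; pose inf n f := forall N, exists m, N <= m /\ forall v, v < n -> c m v = f v.
have step n f : inf n f -> exists a, inf n.+1 (upd f n a).
  move=> hf; apply: NNPP => hn.
  have bad a : exists N, forall m, N <= m -> ~ (forall v, v < n.+1 -> c m v = upd f n a v).
    apply: NNPP => ha; apply: hn; exists a => N; apply: NNPP => hN; apply: ha; exists N => m hm h.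
    by apply: hN; exists m.
  have [N hN] : exists N, forall a, a < k -> forall m, N <= m ->
      ~ (forall v, v < n.+1 -> c m v = upd f n a v).
    elim: (k) => [|k' [N hN]]; first by exists 0.
    have [N' hN'] := bad k'; exists (maxn N N') => a; rewrite ltnS leq_eqVlt.
    by move=> /orP[/eqP ->|ha] m hm; [apply: hN' | apply: hN]; lia.
  have [m [hm hv]] := hf (maxn N n.+1).
  apply: (hN (c m n) _ m) => [||v]; [by apply: hc; lia | by lia |].
  by rewrite ltnS leq_eqVlt /upd; case: eqP => [-> //|_ /= /hv].
have step' n f : exists a, inf n f -> inf n.+1 (upd f n a).
  by case: (classic (inf n f)) => [/step[a h]|h]; [exists a | exists 0].
pose g n f := proj1_sig (constructive_indefinite_description _ (step' n f)).
have hg n f : inf n f -> inf n.+1 (upd f n (g n f)).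
  exact: proj2_sig (constructive_indefinite_description _ (step' n f)).
pose F := fix F n := if n is n'.+1 then upd (F n') n' (g n' (F n')) else (fun _ => 0).
have hF n : inf n (F n).
  by elim: n => [|n IH]; [move=> N; exists N | apply: hg].
have stable n v : v < n -> F n v = F v.+1 v.
  elim: n => // n IH; rewrite ltnS leq_eqVlt => /orP[/eqP -> //|hv].
  by rewrite -IH //= /upd; case: eqP => //; lia.
exists (fun v => F v.+1 v) => n; have [m [hm hv]] := hF n n.
by exists m; split=> // v hvn; rewrite hv // stable.
Qed.

(** Compactness: bad colourings of longer and longer intervals yield one bad colouring of all
    integers. A class of the limit restricted to [v < m] lies in a class of some finite bad
    colouring, so upward closure transfers the failure. *)
Lemma not_large (Q : nat -> (nat -> Prop) -> Prop) : (forall M, upclosed (Q M)) -> ~ large Q ->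
  exists M N k c, (forall v, c v < k) /\ forall q m, q < k -> ~ Q M (part c q N m).
Proof.
move=> uQ /not_all_ex_not[M] /not_all_ex_not[N] /not_all_ex_not[k] hk.
have ex m : exists s, (forall v, v < m -> dec s v < k) /\
    forall q, q < k -> ~ Q M (part (dec s) q N m).
  apply: NNPP => hn; apply: hk; exists m => s hs; apply: NNPP => h; apply: hn.
  by exists s; split=> // q hq hQ; apply: h; exists q.
pose g m := proj1_sig (constructive_indefinite_description _ (ex m)).
have hg m : (forall v, v < m -> dec (g m) v < k) /\
    forall q, q < k -> ~ Q M (part (dec (g m)) q N m).
  exact: proj2_sig (constructive_indefinite_description _ (ex m)).
have [d hd] := konig (fun m => (hg m).1).
exists M, N, k, d; split=> [v|q m hq h].
  by have [m [hm hv]] := hd v.+1; rewrite -hv //; apply: (hg m).1.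
have [m' [hm' hv]] := hd m; apply: ((hg m').2 q hq); apply: uQ h => v [h1 [h2 h3]].
by split=> //; split; [lia | rewrite hv].
Qed.

(** * The ideal of small sets *)

Definition full (Y : nat -> Prop) : Prop :=
  forall f i, chosen (fcode f) i -> cls chosen f i Y.

(** The ideal generated by the finite sets and the sets that are not [full]. *)
Definition small (X : nat -> Prop) : Prop := exists N k (Ys : nat -> nat -> Prop),
  (forall q, q < k -> ~ full (Ys q)) /\
  forall v, N <= v -> X v -> exists q, q < k /\ Ys q v.

Lemma small_sub (X X' : nat -> Prop) : (forall v, X v -> X' v) -> small X' -> small X.
Proof. by move=> s [N [k [Ys [h1 h2]]]]; exists N, k, Ys; split=> // v hv /s; apply: h2. Qed.

Lemma small_union X X' : small X -> small X' -> small (fun v => X v \/ X' v).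
Proof.
move=> [N [k [Ys [h1 h2]]]] [N' [k' [Ys' [h1' h2']]]].
exists (maxn N N'), (k + k'), (fun q => if q < k then Ys q else Ys' (q - k)); split.
  by move=> q hq; case: ltnP => h; [apply: h1 | apply: h1'; lia].
move=> v; rewrite geq_max => /andP[hv hv'] [/(h2 v hv)|/(h2' v hv')] [q [hq hY]].
  by exists q; rewrite hq; split=> //; lia.
exists (k + q); split; first by lia.
by case: ltnP => [|_]; [lia | rewrite addKn].
Qed.

Lemma small_tail N X : small (fun v => X v /\ N <= v) -> small X.
Proof.
move=> [N' [k [Ys [h1 h2]]]]; exists (maxn N N'), k, Ys; split=> // v hv hX.
by apply: h2; [lia | split=> //; lia].
Qed.

Lemma not_small_full X : ~ small X -> full X.
Proof.
move=> h; apply: NNPP => hf; apply: h; exists 0, 1, (fun=> X).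
by split=> // v _ hX; exists 0.
Qed.

Lemma not_small_infinite X m : ~ small X -> exists v, m <= v /\ X v.
Proof.
move=> h; apply: NNPP => hn; apply: h; exists m, 0, (fun=> X).
by split=> // v hv hX; case: hn; exists v.
Qed.

Lemma not_small_colour X N k c : ~ small X -> (forall v, c v < k) ->
  exists q, q < k /\ ~ small (fun v => X v /\ N <= v /\ c v = q).
Proof.
move=> hX hc; apply: NNPP => hn; apply: hX; apply: (@small_tail N).
suff : forall l, l <= k -> small (fun v => X v /\ N <= v /\ c v < l).
  by move/(_ k (leqnn k)); apply: small_sub => v [h1 h2].
elim=> [|l IH] hl; first by exists 0, 0, (fun=> X); split=> // v _ [_ []].
apply: small_sub (small_union (X' := fun v => X v /\ N <= v /\ c v = l) (IH (ltnW hl)) _).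
  by move=> v [h1 [h2]]; rewrite ltnS leq_eqVlt => /orP[/eqP h|h]; [right | left].
by apply: NNPP => h; apply: hn; exists l.
Qed.

(** Largeness survives each greedy addition, by an inner induction on the indices of a family and an
    outer one on the families. *)
Lemma large_base n : large (base chosen n).
Proof.
elim: n => [|n IH].
  (* No class is imposed yet; [m = 1] ensures that some colour below [k] exists. *)
  move=> M N k; exists 1 => s hs; exists (dec s 0); split; first exact: hs.
  by move=> j.
case: (classic (exists f, fcode f = n)) => [[f hf]|hn]; last first.
  move=> M N k; have [m hm] := IH M N k; exists m => s /hm[q [hq hb]]; exists q; split=> //.
  move=> j; rewrite ltnS leq_eqVlt => /orP[/eqP ->|hj]; last exact: hb.
  by move=> i _ _ f hf; case: hn; exists f.
have claim I : large (fun M Y => base chosen n M Y /\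
    forall l, l < I -> chosen n l -> cls chosen f l Y).
  elim: I => [|I IHI].
    by move=> M N k; have [m hm] := IH M N k; exists m => s /hm[q [hq hb]]; exists q.
  case: (classic (chosen n I)) => hI.
    have := hI; rewrite -hf => /chosenP h M N k; have [m hm] := h M N k.
    exists m => s /hm[q [hq [h1 [h2 h3]]]]; exists q; split=> //.
    split; first exact: h1.
    by move=> l; rewrite ltnS leq_eqVlt => /orP[/eqP -> //|hl]; apply: h2.
  move=> M N k; have [m hm] := IHI M N k; exists m => s /hm[q [hq [h1 h2]]]; exists q.
  split=> //; split; first exact: h1.
  by move=> l; rewrite ltnS leq_eqVlt => /orP[/eqP -> //|hl]; apply: h2.
(* In [base] the bound [M] applies to the indices of every family, so the claim is used with
   [I = M]. *)
move=> M N k; have [m hm] := claim M M N k; exists m => s /hm[q [hq [h1 h2]]]; exists q.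
split=> // j; rewrite ltnS leq_eqVlt => /orP[/eqP ->|hj]; last exact: h1.
by move=> i hi hc g hg; rewrite (@fcode_inj g f) ?hg ?hf //; apply: h2.
Qed.

(** A cover of a final segment by finitely many sets that are not full is a colouring. Each set
    misses some chosen class, and finitely many classes suffice for all of them, against
    largeness. *)
Lemma not_small_all : ~ small (fun _ => True).
Proof.
move=> [N [k [Ys [h1 h2]]]].
have [n [M hnM]] : exists n M, forall q, q < k -> exists f i,
    [/\ fcode f < n, i < M, chosen (fcode f) i & ~ cls chosen f i (Ys q)].
  elim: k h1 {h2} => [|k IH] h1; first by exists 0, 0.
  have [n [M h]] := IH (fun q hq => h1 q (leqW hq)).
  have [f [i [hf hi]]] : exists f i, chosen (fcode f) i /\ ~ cls chosen f i (Ys k).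
    apply: NNPP => hn; apply: (h1 k (ltnSn k)) => f i hc; apply: NNPP => hK; apply: hn.
    by exists f, i.
  exists (maxn n (fcode f).+1), (maxn M i.+1) => q; rewrite ltnS leq_eqVlt => /orP[/eqP ->|hq].
    by exists f, i; split=> //; lia.
  by have [g [l [? ? ? ?]]] := h q hq; exists g, l; split=> //; lia.
have ex v : exists q, q < k /\ (N <= v -> Ys q v).
  case: (leqP N v) => hv; first by have [q [hq hY]] := h2 v hv I; exists q.
  (* Integers below [N] may be uncovered; they receive the colour of [N], which keeps all colours
     below [k]. *)
  by have [q [hq hY]] := h2 N (leqnn N) I; exists q.
pose g v := proj1_sig (constructive_indefinite_description _ (ex v)).
have hg v : g v < k /\ (N <= v -> Ys (g v) v).
  exact: proj2_sig (constructive_indefinite_description _ (ex v)).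
have [m hm] := large_base n M N k; have [s hs] := dec_exists g m.
have [v hv|q [hq hb]] := hm s; first by rewrite hs hv; apply: (hg v).1.
have [f [i [hf hi hc hK]]] := hnM q hq; apply: hK.
apply: (fchar_cls _ _ _).1 (hb _ hf i hi hc f erefl) => v [h3 [h4]].
by rewrite hs h4 => <-; apply: (hg v).2.
Qed.

(** Adding the class would destroy largeness, so compactness gives a colouring none of whose colours
    satisfies all the requirements. Some colour meets [X] in a set that is not small, hence full: it
    satisfies the requirements on chosen classes and must fail the one on the new class. *)
Lemma shrink f i X : ~ chosen (fcode f) i -> ~ small X ->
  exists X', [/\ (forall v, X' v -> X v : Prop), ~ small X' & ~ cls chosen f i X'].
Proof.
rewrite chosenP => hl hX.
have fQ M : fchar (fun Y => base chosen (fcode f) M Y /\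
    (forall l, l < i -> chosen (fcode f) l -> cls chosen f l Y) /\ cls chosen f i Y).
  apply: fchar_and (fchar_base _ _ _) (fchar_and _ (fchar_cls _ _ _)).
  by apply: fchar_ball => l; apply: fchar_imp; apply: fchar_cls.
have [M [N [k [c [hc hn]]]]] := not_large (fun M => (fQ M).1) hl.
have [q [hq hX']] := not_small_colour N hX hc.
exists (fun v => X v /\ N <= v /\ c v = q); split=> // [v []//|hK].
have hU := not_small_full hX'.
have [|m hm] := (fQ M).2 (fun v => X v /\ N <= v /\ c v = q).
  split=> [j hj l hl' hc' g hg|]; first by apply: hU; rewrite hg.
  by split=> // l _; apply: hU.
by apply: (hn q m hq); apply: (fQ M).1 hm => v [[_ [h1 h2]] h3].
Qed.

Lemma clsE S f t E Y : cls S f (ccons t E) Y <-> exists t', ext t t' Y /\ forces S f t' E.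
Proof. by rewrite /cls dec_ccons cdrop_ccons. Qed.

Lemma ext_trans s t u X Y : (forall v, Y v -> X v : Prop) -> ext s t X -> ext t u Y -> ext s u X.
Proof.
move=> sub [h1 h2] [h3 h4]; split=> v hv; first exact/h3/h1.
by case: (h4 v hv) => [/h2//|/sub]; right.
Qed.

Lemma ext_refl s X : ext s s X. Proof. by split=> // v; left. Qed.

(** * Conditions and the two forcing relations *)

Definition cond := (nat * (nat -> Prop))%type.

Definition ok (p : cond) := ~ small p.2.
Definition le_cond (p q : cond) := ext q.1 p.1 q.2 /\ forall v, p.2 v -> q.2 v : Prop.

Lemma le_cond_trans p q r : le_cond p q -> le_cond q r -> le_cond p r.
Proof.
move=> [h1 h2] [h3 h4]; split=> [|v /h2 /h4 //]; exact: ext_trans h4 h3 h1.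
Qed.

Lemma le_cond_refl p : le_cond p p.
Proof. by split=> //; apply: ext_refl. Qed.

(* Same as [forces], except that a negation is witnessed by the reservoir: this
   is the relation that persists under extension of conditions. *)
Fixpoint sforces (f : form) (p : cond) (E : nat) : Prop :=
  match f with
  | Lt u j => teval u (dec E) < dec E j
  | Orc i => dec p.1 (dec E i) <> 0
  | Not f => ~ cls chosen f (ccons p.1 E) p.2
  | And f g => sforces f p E /\ sforces g p E
  | Ex f => exists v, sforces f p (ccons v E)
  end.

Lemma sforces_mono f p q E : le_cond q p -> sforces f p E -> sforces f q E.
Proof.
move=> hqp; elim: f E => [u j|i|f IH|f IHf g IHg|f IH] E //=.
- by case: hqp => -[h _] _; apply: h.
- rewrite !clsE => h [t [h1 h2]]; apply: h; exists t; split=> //.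
  by case: hqp => h3 h4; apply: ext_trans h4 h3 h1.
- by move=> [/IHf h1 /IHg h2].
- by move=> [v /IH]; exists v.
Qed.

(** A reservoir that is not small meets every chosen class, so a class that it avoids was not
    chosen. *)
Lemma sforces_forces f p E : ok p -> sforces f p E -> forces chosen f p.1 E.
Proof.
move=> hp; elim: f E => [u j|i|f IH|f IHf g IHg|f IH] E //=.
- by move=> h hc; apply: h; apply: not_small_full hp _ _ hc.
- by move=> [/IHf h1 /IHg h2].
- by move=> [v /IH]; exists v.
Qed.

(** Each negation met in [f] is realized by an application of [shrink]; in a conjunction the
    reservoir is shrunk twice, and the first member persists. *)
Lemma forces_sforces f s X E : ~ small X -> forces chosen f s E ->
  exists X', [/\ (forall v, X' v -> X v : Prop), ~ small X' & sforces f (s, X') E].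
Proof.
elim: f X E => [u j|i|f IH|f IHf g IHg|f IH] X E hX /=.
- by exists X.
- by exists X.
- by move=> /(shrink (f := f)) /(_ hX).
- move=> [/(IHf _ _ hX)[X1 [s1 h1 f1]] /(IHg _ _ h1)[X2 [s2 h2 f2]]].
  exists X2; split=> //; first by move=> v /s2 /s1.
  by split=> //; apply: sforces_mono f1; split=> //; apply: ext_refl.
- by move=> [v /(IH _ _ hX)[X1 [s1 h1 f1]]]; exists X1; split=> //; exists v.
Qed.

Lemma cls_extend f p E : ok p -> cls chosen f (ccons p.1 E) p.2 ->
  exists q, [/\ ok q, le_cond q p & sforces f q E].
Proof.
move=> hp /clsE[t [ht hf]]; have [X' [h1 h2 h3]] := forces_sforces hp hf.
by exists (t, X').
Qed.

Lemma decide f E p : ok p ->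
  exists q, [/\ ok q, le_cond q p & sforces f q E \/ sforces (Not f) q E].
Proof.
move=> hp; case: (classic (cls chosen f (ccons p.1 E) p.2)) => h.
  by have [q [h1 h2 h3]] := cls_extend hp h; exists q; split=> //; left.
by exists p; split=> //; [apply: le_cond_refl | right].
Qed.

Lemma add_element m p : ok p ->
  exists q, [/\ ok q, le_cond q p & exists v, m <= v /\ dec q.1 v <> 0].
Proof.
move=> hp; have [v [hv hX]] := not_small_infinite m hp.
have [t ht] := dec_exists (fun i => if i == v then 1 else dec p.1 i)
  (maxn v.+1 (size (CodeSeq.decode p.1))).
have h0 i : maxn v.+1 (size (CodeSeq.decode p.1)) <= i -> dec p.1 i = 0.
  by move=> hi; rewrite /dec nth_default //; lia.
exists (t, p.2); split=> //; last first.
  by exists v; split=> //=; rewrite ht eqxx leq_max ltnSn.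
split=> //; split=> i /=; rewrite ht.
  by case: ltnP => [_|/h0 //]; case: eqP.
by case: ltnP => // _; case: eqP => [->|]; [right | left].
Qed.

(** The set [W] is arithmetical, so it differs from [B] at some [x]. If [x] is in [W], the reservoir
    meets the class and [f] can be forced at [x]; otherwise a smaller reservoir avoids the class,
    which forces the negation. *)
Lemma disagree (B : natset) (hB : ~ arithmetical B) f p : ok p ->
  exists q, [/\ ok q, le_cond q p & exists x,
    (sforces f q (ccons x 0) /\ ~ B x) \/ (sforces (Not f) q (ccons x 0) /\ B x)].
Proof.
move=> hp; pose W x := chosen (fcode f) (ccons p.1 (ccons x 0)).
have hW : Df emptyset (fun e => W (e 0)) by apply: (Df_app1 (Df_chosen (fcode f))); df.
have [x hx] : exists x, ~ (W x <-> B x).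
  apply: NNPP => h; apply: hB; have -> : B = fun x => asbool (W x).
    apply: functional_extensionality => x; apply/idP/asboolP => hx.
      by apply: NNPP => hn; apply: h; exists x; tauto.
    by apply: NNPP => hn; apply: h; exists x; tauto.
  exact: Df_arithmetical.
case: (classic (W x)) => h.
  have [q [h1 h2 h3]] := cls_extend hp (not_small_full hp h).
  by exists q; split=> //; exists x; left; tauto.
have [X' [h1 h2 h3]] := shrink h hp.
exists (p.1, X'); split=> //; first by split=> //; apply: ext_refl.
by exists x; right; split=> //; tauto.
Qed.

(** * Truth in the generic set *)

Section Truth.
Variables (P : nat -> cond) (G : natset).
Hypothesis okP : forall n, ok (P n).
Hypothesis decP : forall n, le_cond (P n.+1) (P n).
Hypothesis decideP : forall f E, exists n, sforces f (P n) E \/ sforces (Not f) (P n) E.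
Hypothesis GE : forall v, G v <-> exists n, dec (P n).1 v <> 0.

Lemma cond_mono m n : m <= n -> le_cond (P n) (P m).
Proof.
elim: n => [|n IH]; first by rewrite leqn0 => /eqP ->; apply: le_cond_refl.
rewrite leq_eqVlt => /orP[/eqP ->|/IH h]; first exact: le_cond_refl.
exact: le_cond_trans (decP n) h.
Qed.

Lemma truth f E : sat G f (dec E) <-> exists n, sforces f (P n) E.
Proof.
elim: f E => [u j|i|f IH|f IHf g IHg|f IH] E /=.
- by split=> [h|[]//]; exists 0.
- exact: GE.
- rewrite IH; split=> [h|[n hn] [m hm]].
    have [n [hn|hn]] := decideP f E; first by case: h; exists n.
    by exists n.
  (* Both [f] and its negation would be forced by the later of the two conditions; its finite set,
     being an extension of itself, then contradicts the negation clause. *)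
  have hm' := sforces_mono (cond_mono (leq_maxr n m)) hm.
  have /= := @sforces_mono (Not f) _ _ E (cond_mono (leq_maxl n m)) hn.
  apply; apply/clsE; exists (P (maxn n m)).1; split; first exact: ext_refl.
  exact: sforces_forces hm'.
- rewrite IHf IHg; split=> [[[n hn] [m hm]]|[n [h1 h2]]]; last by split; exists n.
  exists (maxn n m); split.
    exact: sforces_mono (cond_mono (leq_maxl n m)) hn.
  exact: sforces_mono (cond_mono (leq_maxr n m)) hm.
- split=> [[v]|[n [v hv]]]; last by exists v; rewrite -dec_scons IH; exists n.
  by rewrite -dec_scons IH => -[n hn]; exists n, v.
Qed.

End Truth.

(** * Construction of the generic set *)

Lemma generic_sequence (D : nat -> cond -> Prop) p0 : ok p0 ->
  (forall n p, ok p -> exists q, [/\ ok q, le_cond q p & D n q]) ->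
  exists P, [/\ P 0 = p0, forall n, ok (P n), forall n, le_cond (P n.+1) (P n)
    & forall n, D n (P n.+1)].
Proof.
move=> h0 dense.
have ex n p : exists q, ok p -> [/\ ok q, le_cond q p & D n q].
  by case: (classic (ok p)) => [/(dense n)[q hq]|h]; [exists q | exists p].
pose g n p := proj1_sig (constructive_indefinite_description _ (ex n p)).
have hg n p : ok p -> [/\ ok (g n p), le_cond (g n p) p & D n (g n p)].
  exact: proj2_sig (constructive_indefinite_description _ (ex n p)).
pose P := fix P n := if n is n'.+1 then g n' (P n') else p0.
have okP n : ok (P n) by elim: n => // n /(hg n)[].
by exists P; split=> // n; case: (hg n _ (okP n)).
Qed.

Theorem theorem2 (B : natset) (hB : ~ arithmetical B) (A : natset) :
  exists H : natset,
    [/\ infinite_set H,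
        (forall n, H n -> A n) \/ (forall n, H n -> ~~ A n)
      & ~ arithmetical_in H B].
Proof.
(* Small sets form a proper ideal, so [A] or its complement can serve as the initial reservoir. *)
suff main (X0 : nat -> Prop) : ~ small X0 ->
    exists H : natset, [/\ infinite_set H, forall n, H n -> X0 n & ~ arithmetical_in H B].
  case: (classic (small (fun v => A v))) => hA; last first.
    by have [H [h1 h2 h3]] := main _ hA; exists H; split=> //; left.
  case: (classic (small (fun v => ~~ A v))) => hA'; last first.
    by have [H [h1 h2 h3]] := main _ hA'; exists H; split=> //; right.
  case: not_small_all; apply: small_sub (small_union hA hA') => v _.
  by case: (A v); [left | right].
move=> hX0.
(* The number [n] is read as a list of tasks: a bound to be reached by an element, the code of a
   formula, and an environment in which to decide it. *)
pose D n (p : cond) := (exists v, dec n 0 <= v /\ dec p.1 v <> 0) /\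
  forall f, fcode f = dec n 1 ->
   (sforces f p (dec n 2) \/ sforces (Not f) p (dec n 2)) /\
   exists x, (sforces f p (ccons x 0) /\ ~ B x) \/ (sforces (Not f) p (ccons x 0) /\ B x).
(* The number 0 codes the empty set, so all elements of the generic set come from [X0]. *)
have [||P [P0 okP decP DP]] := @generic_sequence D (0, X0) => // [n p hp|].
  have [p1 [ok1 le1 [v [hv hv1]]]] := add_element (dec n 0) hp.
  have D1 q : le_cond q p1 -> exists v, dec n 0 <= v /\ dec q.1 v <> 0.
    by case=> -[h _] _; exists v; split=> //; apply: h.
  case: (classic (exists f, fcode f = dec n 1)) => [[f hf]|hn]; last first.
    exists p1; split=> //; split; first exact/D1/le_cond_refl.
    by move=> f hf; case: hn; exists f.
  have [p2 [ok2 le2 h2]] := decide f (dec n 2) ok1.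
  have [p3 [ok3 le3 h3]] := disagree hB f ok2.
  have le31 := le_cond_trans le3 le2.
  exists p3; split=> //; first exact: le_cond_trans le31 le1.
  split=> [|g hg]; first exact: D1.
  rewrite (@fcode_inj g f) ?hg ?hf //; split=> //.
  by case: h2 => h; [left | right]; apply: sforces_mono le3 h.
pose H : natset := fun v => asbool (exists n, dec (P n).1 v <> 0).
have HE v : H v <-> exists n, dec (P n).1 v <> 0 by rewrite /H; split=> [/asboolP|/asboolP].
have dP f E : exists n, sforces f (P n) E \/ sforces (Not f) (P n) E.
  exists (CodeSeq.code [:: 0; fcode f; E]).+1.
  by have [_ /(_ f)] := DP (CodeSeq.code [:: 0; fcode f; E]); rewrite !dec_code => /(_ erefl)[].
have tr := truth okP decP dP HE.
exists H; split.
- move=> m; have [[v [hv h]] _] := DP (CodeSeq.code [:: m]).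
  rewrite dec_code in hv; exists v; split=> //; apply/HE.
  by exists (CodeSeq.code [:: m]).+1.
- move=> v /HE[n hn]; have [[_ h] _] := cond_mono decP (leq0n n).
  by case: (h v hn); rewrite P0 //= /dec nth_nil.
(* If [B] were arithmetical in [H], some [f] would define it; but at the stage for [f] a truth value
   opposite to [B] was forced at some [x]. *)
move=> /arithmetical_in_Df[f hf].
pose n := CodeSeq.code [:: 0; fcode f].
have [_ /(_ f)] := DP n; rewrite {1}/n dec_code => /(_ erefl)[_ [x hx]].
have hB' : sat H f (dec (ccons x 0)) <-> B x by rewrite hf dec_ccons.
case: hx => -[h1 h2].
  by apply: h2; apply/hB'/tr; exists n.+1.
have : sat H (Not f) (dec (ccons x 0)) by apply: (tr (Not f) _).2; exists n.+1.
by apply; apply/hB'.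
Qed.
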